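(* Let $X$ be a paracompact complex manifold with a locally finite Stein open cover $\mathcal{U}=\{U_\alpha\}$ all of whose finite intersections are Stein, and let $E$ be a holomorphic vector bundle on $X$ trivialised by $\mathcal{U}$, with flat holomorphic connections $\nabla_\alpha$ on $E|_{U_\alpha}$. Let $\omega_{\alpha\beta}=\nabla_\beta-\nabla_\alpha\in\Gamma(U_{\alpha\beta},\mathcal{E}nd(E)\otimes\Omega^1_X)$. On $U_{\alpha\beta\gamma\delta}$ (and on the larger intersections where they make sense) write $A=\omega_{\alpha\beta}$, $Z=\omega_{\beta\gamma}$, $Y=\omega_{\gamma\delta}$. Then the element $$\Big(0,\ -\tfrac1{10}\operatorname{tr}(A^5),\ \rho(A,Z),\ \operatorname{tr}(AZY),\ 0,\ 0,\ 0\Big)\in \mathrm{Tot}^6\,\check{\mathscr{C}}^\bullet(\Omega_X^\star),$$ where $$\rho(A,Z)=-\tfrac14\operatorname{tr}(AZAZ)+\tfrac12\operatorname{tr}(A^2Z^2)-\tfrac12\operatorname{tr}(A^3Z)-\tfrac12\operatorname{tr}(AZ^3),$$ and whose component of bidegree $(3,3)$ is the trace $\operatorname{tr}\mathrm{at}_E^{\circ3}$ of the third exponential Atiyah class of $E$, is closed.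
   Context: $\check{\mathscr{C}}^p(\Omega_X^q)=\prod_{(\alpha_0,\dots,\alpha_p)}\Gamma(U_{\alpha_0\cdots\alpha_p},\Omega_X^q)$ is the group of Čech $p$-cochains (not assumed skew-symmetric) for $\mathcal{U}$ with values in holomorphic $q$-forms. $\mathrm{Tot}^r\check{\mathscr{C}}^\bullet(\Omega_X^\star)=\bigoplus_{p+q=r}\check{\mathscr{C}}^p(\Omega_X^q)$, whose elements are written $(c_0,\dots,c_r)$ with $c_p\in\check{\mathscr{C}}^p(\Omega_X^{r-p})$. The total differential is $\check\delta+(-1)^p\mathrm{d}$ on $\check{\mathscr{C}}^p(\Omega_X^q)$, where $\check\delta$ is the Čech differential and $\mathrm{d}$ the de Rham differential. The Čech $1$-, $2$- and $3$-cochains above are indexed by $(\alpha,\beta)$, $(\alpha,\beta,\gamma)$ and $(\alpha,\beta,\gamma,\delta)$ respectively. A holomorphic connection is flat if its curvature $\nabla\circ\nabla$ vanishes. The product of endomorphism-valued forms is composition on endomorphisms and wedge product on forms, and all factors are restricted to the relevant intersection. (If the factors are written as matrices in different trivialisations, they must first be conjugated to the $U_\alpha$ trivialisation.) The third exponential Atiyah class $\mathrm{at}_E^{\circ3}\in H^3(X,\mathcal{E}nd(E)\otimes\Omega_X^3)$ is represented by the Čech cocycle $(\mathrm{at}_E^{\circ 3})_{\alpha\beta\gamma\delta}=\omega_{\alpha\beta}\,\omega_{\beta\gamma}\,\omega_{\gamma\delta}$. *)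

(* Defs.v *)
From HB Require Import structures.
From mathcomp Require Import all_boot all_order all_algebra.
From mathcomp Require Import all_classical all_reals all_analysis.
From mathcomp Require Import complex.

Set Implicit Arguments.
Unset Strict Implicit.
Unset Printing Implicit Defensive.

Import Order.TTheory GRing.Theory Num.Theory.
Import numFieldNormedType.Exports.

Local Open Scope classical_set_scope.
Local Open Scope ring_scope.

(* R[i] packaged as a numClosedFieldType: the normed-module structure of
   numFieldNormedType is only inferred on such a structure, not on the bare type
   R[i]. differentiable over it is complex (Frechet) differentiability. *)
Definition Cplx (R : realType) : numClosedFieldType := R[i].

(* Exterior algebra on generators dz_0, ..., dz_(n-1): a I is the coefficient
   of the monomial dz_I, whose factors are taken in increasing order. *)
Definition ext (K : comNzRingType) (n : nat) := {ffun {set 'I_n} -> K^o}.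

HB.instance Definition _ (K : comNzRingType) n := GRing.Lmodule.on (ext K n).

Section ExteriorRing.
Variables (K : comNzRingType) (n : nat).
Implicit Types (I J L S : {set 'I_n}) (a b c : ext K n).

Definition sign1 (i j : 'I_n) : K :=
  if (i < j)%N then 1 else if (j < i)%N then -1 else 0.

(* dz_I /\ dz_J = ext_sign I J *: dz_(I :|: J); the factor for i = j makes it
   vanish as soon as I and J meet *)
Definition ext_sign I J : K := \prod_(i in I) \prod_(j in J) sign1 i j.

Definition ext_mul a b : ext K n :=
  [ffun S => \sum_I \sum_(J | I :|: J == S) ext_sign I J * a I * b J].

Definition ext_one : ext K n := [ffun I => (I == finset.set0)%:R].

Lemma ext_sign_disj I J : I :&: J != finset.set0 -> ext_sign I J = 0.
Proof.
case/set0Pn => i; rewrite finset.in_setI => /andP[iI iJ].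
rewrite /ext_sign (bigD1 i) //= (bigD1 i) //= /sign1 ltnn.
by rewrite !mul0r.
Qed.

Lemma prod_setU I J (F : 'I_n -> K) : I :&: J = finset.set0 ->
  \prod_(i in I :|: J) F i = (\prod_(i in I) F i) * \prod_(i in J) F i.
Proof.
move=> dIJ; rewrite (big_setID I) /= finset.setIUl finset.setIid.
rewrite (finset.setIC J) dIJ finset.setU0; congr (_ * _).
rewrite finset.setDUl finset.setDv finset.set0U.
apply: eq_bigl => i; rewrite finset.in_setD; case: (boolP (i \in J)) => iJ.
  rewrite andbT; apply/negP => iI.
  by move/finset.setP: dIJ => /(_ i); rewrite !inE iI iJ.
by rewrite andbF.
Qed.

Lemma ext_signUl I J L : I :&: J = finset.set0 ->
  ext_sign (I :|: J) L = ext_sign I L * ext_sign J L.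
Proof. exact: prod_setU. Qed.

Lemma ext_signUr I J L : J :&: L = finset.set0 ->
  ext_sign I (J :|: L) = ext_sign I J * ext_sign I L.
Proof.
move=> dJL; rewrite /ext_sign -big_split /=.
by apply: eq_bigr => i _; rewrite prod_setU.
Qed.

Lemma ext_sign_cocycle I J L :
  ext_sign I (J :|: L) * ext_sign J L = ext_sign I J * ext_sign (I :|: J) L.
Proof.
have [dIJ|nIJ] := eqVneq (I :&: J) finset.set0; last first.
  rewrite (ext_sign_disj nIJ) mul0r ext_sign_disj ?mul0r //.
  apply: contra nIJ => /eqP e.
  by rewrite -finset.subset0 -e finset.setIS // finset.subsetUl.
have [dJL|nJL] := eqVneq (J :&: L) finset.set0.
  by rewrite ext_signUr // ext_signUl // mulrA.
rewrite (ext_sign_disj nJL) mulr0 [X in _ * X]ext_sign_disj ?mulr0 //.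
apply: contra nJL => /eqP e.
by rewrite -finset.subset0 -e finset.setSI // finset.subsetUr.
Qed.

Lemma ext_mulA : associative ext_mul.
Proof.
move=> a b c; apply/ffunP => S; rewrite !ffunE.
transitivity (\sum_I \sum_J \sum_(L | I :|: (J :|: L) == S)
  ext_sign I (J :|: L) * ext_sign J L * a I * b J * c L).
  apply: eq_bigr => I _.
  under eq_bigr => T _.
    rewrite ffunE mulr_sumr.
    under eq_bigr do rewrite mulr_sumr.
    over.
  rewrite exchange_big /=; apply: eq_bigr => J _.
  rewrite (exchange_big_dep xpredT) //= [RHS]big_mkcond /=.
  apply: eq_bigr => L _.
  rewrite (eq_bigl (fun T => (T == J :|: L) && (I :|: (J :|: L) == S))); last first.
    move=> T; rewrite [J :|: L == T]eq_sym andbC.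
    by case: eqP => // ->.
  case: ifP => h; last by rewrite big1 // => T /andP[].
  rewrite (eq_bigl (pred1 (J :|: L))); last by move=> T; rewrite andbT.
  by rewrite big_pred1_eq !mulrA; congr (_ * _); rewrite -!mulrA; congr (_ * _); rewrite mulrCA.
apply: esym.
transitivity (\sum_L \sum_I \sum_J if I :|: (J :|: L) == S then
  ext_sign I (J :|: L) * ext_sign J L * a I * b J * c L else 0); last first.
  rewrite exchange_big /=; apply: eq_bigr => I _.
  rewrite exchange_big /=; apply: eq_bigr => J _.
  by rewrite [RHS]big_mkcond.
rewrite (exchange_big_dep xpredT) //=; apply: eq_bigr => L _.
under eq_bigr => T _.
  rewrite ffunE mulr_sumr mulr_suml.
  under eq_bigr do rewrite mulr_sumr mulr_suml.
  over.
rewrite exchange_big /=; apply: eq_bigr => I _.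
rewrite (exchange_big_dep xpredT) //=; apply: eq_bigr => J _.
rewrite (eq_bigl (fun T => (T == I :|: J) && (I :|: (J :|: L) == S))); last first.
  move=> T; rewrite [I :|: J == T]eq_sym andbC finset.setUA.
  by case: eqP => // ->.
case: ifP => h; last by rewrite big1 // => T /andP[].
rewrite (eq_bigl (pred1 (I :|: J))); last by move=> T; rewrite andbT.
rewrite big_pred1_eq ext_sign_cocycle; congr (_ * _).
by rewrite [X in _ = X * _ * _]mulrC !mulrA.
Qed.

Lemma ext_sign0l J : ext_sign finset.set0 J = 1.
Proof. by rewrite /ext_sign big_set0. Qed.

Lemma ext_sign0r I : ext_sign I finset.set0 = 1.
Proof. by rewrite /ext_sign big1 // => i _; rewrite big_set0. Qed.

Lemma ext_mul1l : left_id ext_one ext_mul.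
Proof.
move=> a; apply/ffunP => S; rewrite ffunE (bigD1 finset.set0) //=.
rewrite [X in _ + X]big1 ?addr0 => [|I nI]; last first.
  by rewrite big1 // => J _; rewrite ffunE (negPf nI) mulr0 mul0r.
rewrite (eq_bigl (pred1 S)); last by move=> J; rewrite finset.set0U.
by rewrite big_pred1_eq ext_sign0l ffunE eqxx !mul1r.
Qed.

Lemma ext_mul1r : right_id ext_one ext_mul.
Proof.
move=> a; apply/ffunP => S; rewrite ffunE (bigD1 S) //=.
rewrite [X in _ + X]big1 ?addr0 => [|I nI].
  rewrite (bigD1 finset.set0) ?finset.setU0 //= ext_sign0r ffunE eqxx mulr1 mul1r.
  by rewrite big1 ?addr0 // => J /andP[_ nJ]; rewrite ffunE (negPf nJ) mulr0.
rewrite big1 // => J /eqP IJS; rewrite ffunE.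
case: eqP => [J0|]; last by rewrite mulr0.
by move: nI; rewrite -IJS J0 finset.setU0 eqxx.
Qed.

Lemma ext_mulDl : left_distributive ext_mul +%R.
Proof.
move=> a b c; apply/ffunP => S; rewrite !ffunE -big_split /=.
apply: eq_bigr => I _; rewrite -big_split /=; apply: eq_bigr => J _.
by rewrite ffunE mulrDr mulrDl.
Qed.

Lemma ext_mulDr : right_distributive ext_mul +%R.
Proof.
move=> a b c; apply/ffunP => S; rewrite !ffunE -big_split /=.
apply: eq_bigr => I _; rewrite -big_split /=; apply: eq_bigr => J _.
by rewrite ffunE mulrDr.
Qed.

Lemma ext_one_neq0 : ext_one != 0.
Proof.
apply/eqP => /ffunP/(_ finset.set0); rewrite !ffunE eqxx => /eqP.
by rewrite oner_eq0.
Qed.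

HB.instance Definition _ := GRing.Zmodule_isNzRing.Build (ext K n)
  ext_mulA ext_mul1l ext_mul1r ext_mulDl ext_mulDr ext_one_neq0.

Definition dz (l : 'I_n) : ext K n := [ffun I => (I == [set l]%SET)%:R].

Definition homogeneous (q : nat) a : Prop := forall I, #|I| <> q -> a I = 0.

End ExteriorRing.

(* The algebra morphism induced by dz_k |-> \sum_l J l k *: dz_l, i.e. the
   pull-back of forms along a map with Jacobian matrix J (library convention:
   row l holds the partial derivatives with respect to the l-th variable). *)
Definition pullback (K : comNzRingType) m n (J : 'M[K]_(m, n)) (a : ext K n) :
    ext K m :=
  \sum_(I : {set 'I_n})
    (a I : K) *: \prod_(k <- enum I) \sum_(l < m) J l k *: dz K l.

(* Complex manifolds; the dimension may depend on the chart. cinv i inverts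
   the chart cmap i on its image and is arbitrary elsewhere. *)
Record cmanifold (R : realType) := CManifold {
  cspace :> topologicalType;
  chart : Type;
  cdim : chart -> nat;
  cdom : chart -> set cspace;
  cmap : forall i, cspace -> 'rV[Cplx R]_(cdim i);
  cinv : forall i, 'rV[Cplx R]_(cdim i) -> cspace;
  cspace_hausdorff : hausdorff_space cspace;
  cdom_cover : forall x, exists i, cdom i x;
  cdom_open : forall i, open (cdom i);
  cmap_open : forall i, open (cmap i @` cdom i);
  cmapK : forall i x, cdom i x -> cinv (cmap i x) = x;
  cmap_cont : forall i x, cdom i x -> {for x, continuous (@cmap i)};
  cinv_cont : forall i x, cdom i x -> {for cmap i x, continuous (@cinv i)};
  ctrans_holo : forall i j x, cdom i x -> cdom j x ->
    differentiable (@cmap j \o @cinv i) (cmap i x)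
}.

Section Manifold.
Variables (R : realType) (X : cmanifold R).
Notation C := (Cplx R).

Definition locally_finite_family (I : Type) (V : I -> set X) : Prop :=
  forall x : X, exists2 N, nbhs x N & finite_set [set i | V i `&` N !=set0].

Definition paracompact : Prop :=
  forall (I : Type) (V : I -> set X),
    (forall i, open (V i)) -> \bigcup_i V i = setT ->
  exists (J : Type) (W : J -> set X),
    [/\ (forall j, open (W j)), \bigcup_j W j = setT,
        (forall j, exists i, W j `<=` V i) & locally_finite_family W].

Definition holomorphic_on (V : set X) (f : X -> C) : Prop :=
  forall (i : chart X) x, V x -> cdom i x ->
    differentiable (f \o @cinv R X i) (cmap i x).

(* {x in V | |f x| <= sup_K |f| for all holomorphic f on V} *)
Definition holo_hull (V K : set X) : set X :=
  [set x | V x /\ forall f (M : C), holomorphic_on V f ->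
     (forall y, K y -> `|f y| <= M) -> `|f x| <= M].

(* holomorphic convexity and holomorphic separability *)
Definition stein (V : set X) : Prop :=
  [/\ open V,
      (forall K, compact K -> K `<=` V -> compact (holo_hull V K)) &
      (forall x y, V x -> V y -> x <> y ->
         exists2 f, holomorphic_on V f & f x <> f y)].

(* A differential form is given by its coordinate expressions in the charts;
   only the values eta i x with x in cdom i and in the open set under
   consideration are meaningful. is_form q V eta: eta is in Gamma(V, Omega^q). *)
Definition form := forall (i : chart X), X -> ext C (cdim i).

Definition is_form (q : nat) (V : set X) (eta : form) : Prop :=
  [/\ (forall i x, V x -> cdom i x -> homogeneous q (eta i x)),
      (forall i j x, V x -> cdom i x -> cdom j x ->
         eta i x = pullback (jacobian (@cmap R X j \o @cinv R X i) (cmap i x))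
                     (eta j x)) &
      (forall i (I : {set 'I_(cdim i)}) x, V x -> cdom i x ->
         differentiable (fun z => eta i (cinv z) I : C) (cmap i x))].

Definition eq_form (V : set X) (eta zeta : form) : Prop :=
  forall i x, V x -> cdom i x -> eta i x = zeta i x.

Definition form0 : form := fun i x => 0.

(* \sum_l dz_l /\ (d eta / d z_l) in each chart *)
Definition dform (eta : form) : form := fun i x =>
  \sum_(l < cdim i) dz C l *
    ([ffun I : {set 'I_(cdim i)} =>
       'D_(delta_mx 0 l) (fun z => eta i (cinv z) I : C) (cmap i x)]
     : ext C (cdim i)).

Definition fun_form (f : X -> C) : form := fun i x => f x *: (1 : ext C (cdim i)).

Section Cech.
Variables (A : Type) (U : A -> set X).

Definition Ucap p (a : 'I_p.+1 -> A) : set X := [set x | forall k, U (a k) x].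

Definition cochain (p : nat) := ('I_p.+1 -> A) -> form.

Definition is_cochain p q (c : cochain p) : Prop :=
  forall a, is_form q (Ucap a) (c a).

Definition cech_d p (c : cochain p) : cochain p.+1 := fun a i x =>
  \sum_(j < p.+2) (-1) ^+ j *: c (a \o lift j) i x.

Definition tot_cochain := forall p, cochain p.

(* elements (c_0, ..., c_r) of Tot^r, with c_p = 0 for p > r *)
Definition is_tot (r : nat) (c : tot_cochain) : Prop :=
  (forall p, (p <= r)%N -> is_cochain (r - p) (c p)) /\
  (forall p a, (r < p)%N -> eq_form (Ucap a) (c p a) form0).

Definition tot_d (c : tot_cochain) : tot_cochain := fun p =>
  match p with
  | 0 => fun a => dform (c 0%N a)
  | p'.+1 => fun a i x =>
      cech_d (c p') a i x + (-1) ^+ p'.+1 *: dform (c p'.+1 a) i x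
  end.

Arguments tot_d : clear implicits.

Definition tot_closed (c : tot_cochain) : Prop :=
  forall p a, eq_form (Ucap a) (tot_d c p a) form0.

(* Holomorphic vector bundles trivialised by the open cover U: a family of
   vector spaces whose holomorphic structure is encoded by frames over the U a
   with holomorphic transition functions. frame a x is arbitrary outside U a;
   the rank may depend on a. *)
Record vbundle := VBundle {
  fiber : X -> vectType C;
  rk : A -> nat;
  frame : forall a x, (rk a).-tuple (fiber x);
  frameP : forall a x, U a x -> basis_of fullv (frame a x);
  frame_trans : forall a b (k : 'I_(rk a)) (l : 'I_(rk b)),
    holomorphic_on (U a `&` U b)
      (fun x => coord (frame a x) k (tnth (frame b x) l))
}.

Variable E : vbundle.

Definition sect := forall x, fiber E x.

Definition is_section (V : set X) (s : sect) : Prop :=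
  forall a (k : 'I_(rk E a)),
    holomorphic_on (V `&` U a) (fun x => coord (frame E a x) k (s x)).

Definition frame_sect a (j : 'I_(rk E a)) : sect :=
  fun x => tnth (frame E a x) j.
Arguments frame_sect : clear implicits.

(* sigma i x I : the coefficient, in the fibre at x, of dz_I in the chart i *)
Definition Eform := forall (i : chart X) x, {ffun {set 'I_(cdim i)} -> fiber E x}.

Definition coordE a (k : 'I_(rk E a)) (sigma : Eform) : form :=
  fun i x => [ffun I => coord (frame E a x) k (sigma i x I)].

Definition is_Eform (q : nat) (V : set X) (sigma : Eform) : Prop :=
  forall a (k : 'I_(rk E a)), is_form q (V `&` U a) (coordE k sigma).

Definition eq_Eform (V : set X) (sigma tau : Eform) : Prop :=
  forall i x, V x -> cdom i x -> sigma i x = tau i x.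

Definition tensE (s : sect) (eta : form) : Eform :=
  fun i x => [ffun I => (eta i x I : C) *: s x].

Definition wedgeE (sigma : Eform) (eta : form) : Eform := fun i x =>
  [ffun S : {set 'I_(cdim i)} =>
     \sum_(I : {set 'I_(cdim i)}) \sum_(J : {set 'I_(cdim i)} | I :|: J == S)
     (ext_sign C I J * (eta i x J : C)) *: sigma i x I].

(* Holomorphic connections on the restriction of E to W: morphisms of sheaves
   of C-vector spaces E -> E (x) Omega^1 over W satisfying the Leibniz rule
   (applied to constants f, it gives homogeneity). nabla V acts on Gamma(V, E). *)
Record connection (W : set X) := Connection {
  nabla :> set X -> sect -> Eform;
  nabla_form : forall V s, open V -> V `<=` W -> is_section V s ->
    is_Eform 1 V (nabla V s);
  nabla_restr : forall V V' s s', open V -> open V' -> V' `<=` V -> V `<=` W ->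
    is_section V s -> is_section V' s' -> (forall x, V' x -> s x = s' x) ->
    eq_Eform V' (nabla V s) (nabla V' s');
  nablaD : forall V s t, open V -> V `<=` W -> is_section V s -> is_section V t ->
    eq_Eform V (nabla V (fun x => s x + t x))
      (fun i x => nabla V s i x + nabla V t i x);
  nabla_leibniz : forall V f s, open V -> V `<=` W -> holomorphic_on V f ->
    is_section V s ->
    eq_Eform V (nabla V (fun x => f x *: s x))
      (fun i x => tensE s (dform (fun_form f)) i x + f x *: nabla V s i x)
}.

(* tau = nabla sigma for the extension of nabla to E (x) Omega^1 by
   nabla (s (x) eta) = nabla s /\ eta + s (x) d eta, expressed through the
   local decompositions sigma = \sum_j s_j (x) eta_j. *)
Definition nabla_ext W (N : connection W) (V : set X) (sigma tau : Eform) : Prop :=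
  forall (V' : set X) m (s : 'I_m -> sect) (eta : 'I_m -> form),
    open V' -> V' `<=` V ->
    (forall j, is_section V' (s j)) -> (forall j, is_form 1 V' (eta j)) ->
    eq_Eform V' sigma (fun i x => \sum_(j < m) tensE (s j) (eta j) i x) ->
    eq_Eform V' tau (fun i x => \sum_(j < m)
      (wedgeE (N V' (s j)) (eta j) i x + tensE (s j) (dform (eta j)) i x)).

Definition flat W (N : connection W) : Prop :=
  forall V s, open V -> V `<=` W -> is_section V s ->
    nabla_ext N V (N V s) (fun i x => 0).

(* endomorphism-valued forms, in a frame: the product of these matrices over
   the exterior algebra composes endomorphisms and wedges forms *)
Definition mxform r := forall (i : chart X), X -> 'M[ext C (cdim i)]_r.

Definition mxtr r (M : mxform r) : form := fun i x => \tr (M i x).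

Variable N : forall a, connection (U a).

(* omega_bc = nabla_c - nabla_b in the frame over U a, on U a `&` U b `&` U c:
   its j-th column holds the coordinates of omega_bc (e_j) *)
Definition omega_in a b c : mxform (rk E a) := fun i x =>
  let V := U a `&` U b `&` U c in
  \matrix_(k, j) coordE k (fun i' y =>
     N c V (frame_sect a j) i' y - N b V (frame_sect a j) i' y) i x.

(* the cocycle representing the third exponential Atiyah class *)
Definition at3 (a : 'I_4 -> A) : mxform (rk E (a 0)) := fun i x =>
  omega_in (a 0) (a 0) (a 1) i x *m omega_in (a 0) (a 1) (a 2) i x
    *m omega_in (a 0) (a 2) (a 3) i x.

Definition rho r (om1 om2 : mxform r) : form := fun i x =>
  let A := om1 i x in let Z := om2 i x in
  - 4^-1 *: \tr (A *m Z *m A *m Z) + 2^-1 *: \tr (A *m A *m Z *m Z)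
  - 2^-1 *: \tr (A *m A *m A *m Z) - 2^-1 *: \tr (A *m Z *m Z *m Z).

(* (0, - tr(A^5)/10, rho(A, Z), tr(A Z Y), 0, 0, 0) *)
Definition at3_tot : tot_cochain := fun p =>
  match p with
  | 1 => fun a i x =>
      let A := omega_in (a 0) (a 0) (a 1) i x in
      - 10^-1 *: \tr (A *m A *m A *m A *m A)
  | 2 => fun a => rho (omega_in (a 0) (a 0) (a 1)) (omega_in (a 0) (a 1) (a 2))
  | 3 => fun a i x =>
      let A := omega_in (a 0) (a 0) (a 1) i x in
      let Z := omega_in (a 0) (a 1) (a 2) i x in
      let Y := omega_in (a 0) (a 2) (a 3) i x in
      \tr (A *m Z *m Y)
  | _ => fun a => form0
  end.

End Cech.
End Manifold.

Arguments at3_tot {R X A U E} N p _ _ _.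

(* Main.v *)
From HB Require Import structures.
From mathcomp Require Import all_boot all_order all_algebra.
From mathcomp Require Import all_classical all_reals all_analysis.
From mathcomp Require Import ring.
Require Import Defs.

Set Implicit Arguments.
Unset Strict Implicit.
Unset Printing Implicit Defensive.

Import Order.TTheory GRing.Theory Num.Theory.
Import numFieldNormedType.Exports.

Local Open Scope classical_set_scope.
Local Open Scope ring_scope.

(** Fix an index a and work in the frame over U_a, where nabla_c has a matrix
    of one-forms Om_c. Then omega_bc = Om_c - Om_b, and flatness of nabla_c
    reads d Om_c = - Om_c ^ 2 ([flat_conn]).

    Let D M = d M + Om_a M - (-1)^q M Om_a be the covariant derivative of a
    matrix M of q-forms. It is a graded derivation ([has_covM]), and
    d tr M = tr (D M) since the trace kills graded commutators
    ([dform_mxtr_cov]). Flatness gives D omega_bc = omega_ab ^ 2 - omega_ac ^ 2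
    ([cov_omega]); for consecutive indices a, b, c, d this says

      D A = - A^2,   D Z = - (A Z + Z A + Z^2),
      D Y = - ((A + Z) Y + Y (A + Z) + Y^2).

    Hence the de Rham differential of each component is a combination of
    traces of words in A, Z, Y. So are the faces in the Cech differential. A
    face that keeps a only involves sums of consecutive letters, because
    omega_ac = A + Z ([omega_add]). The face that omits a is written in the
    frame over U_b; the derivative of the transition matrix cancels in a
    difference of two connections ([conn_change_frame]), so this face is
    obtained from the frame over U_a by conjugation, which no trace sees
    ([mxtrace_conj]).

    Closedness thus becomes one identity between traces of words in odd
    letters for each Cech degree. Moving the first letter of a word of length
    l to its end multiplies the trace by (-1)^(l - 1). In degree one, tr (A^6)
    vanishes, being its own opposite ([der5_pow]). In degrees two and three
    the coefficients of rho make the rotation classes of words cancel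
    ([rho_der_pow5], [rho_tr3]). In degree four, tr (A Z Y) is a Cech cocycle
    by multilinearity ([phi_tr3_cocycle]).

    That the components are cochains rests on the compatibility of pull-backs
    with products ([pullbackM]). *)

(** * The exterior algebra and pull-backs *)

Section ExteriorAlgebra.
Variables (K : comNzRingType) (n : nat).
Implicit Types (I J S : {set 'I_n}) (a b c : ext K n).

Lemma eq_ext a b : (forall S, a S = b S) -> a = b.
Proof. by move=> e; apply/ffunP. Qed.

Lemma extM a b S :
  (a * b) S = \sum_I \sum_(J | I :|: J == S) ext_sign K I J * a I * b J.
Proof. by rewrite ffunE. Qed.

Lemma extZ (k : K) a S : (k *: a) S = k * a S.
Proof. by rewrite ffunE. Qed.

Lemma extD a b S : (a + b) S = a S + b S.
Proof. by rewrite ffunE. Qed.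

Lemma ext0 S : (0 : ext K n) S = 0.
Proof. by rewrite ffunE. Qed.

Lemma extN a S : (- a) S = - a S.
Proof. by rewrite ffunE. Qed.

Lemma ext_sum (T : Type) (r : seq T) (P : pred T) (F : T -> ext K n) S :
  (\sum_(t <- r | P t) F t) S = \sum_(t <- r | P t) F t S.
Proof. by elim/big_rec2: _ => [|t x y _ <-]; rewrite (ext0, extD). Qed.

Lemma ext_scalerAl (k : K) a b : k *: (a * b) = k *: a * b.
Proof.
apply/ffunP => S; rewrite extZ !extM mulr_sumr; apply: eq_bigr => I _.
rewrite mulr_sumr; apply: eq_bigr => J _.
by rewrite extZ !mulrA [k * _]mulrC.
Qed.

Lemma ext_scalerAr (k : K) a b : k *: (a * b) = a * (k *: b).
Proof.
apply/ffunP => S; rewrite extZ !extM mulr_sumr; apply: eq_bigr => I _.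
rewrite mulr_sumr; apply: eq_bigr => J _.
by rewrite extZ mulrCA.
Qed.

HB.instance Definition _ :=
  GRing.Lmodule_isLalgebra.Build K (ext K n) ext_scalerAl.
HB.instance Definition _ :=
  GRing.Lalgebra_isAlgebra.Build K (ext K n) ext_scalerAr.

Lemma sign1C (i j : 'I_n) : sign1 K i j = - sign1 K j i.
Proof. by rewrite /sign1; case: ltngtP => _; rewrite ?oppr0 ?opprK. Qed.

Lemma ext_signC I J :
  ext_sign K I J = (-1) ^+ (#|I| * #|J|) * ext_sign K J I.
Proof.
rewrite /ext_sign [in RHS]exchange_big /= mulnC exprM -prodr_const -big_split /=.
apply: eq_bigr => i _; rewrite -prodr_const -big_split /=.
by apply: eq_bigr => j _; rewrite sign1C mulN1r.
Qed.

Lemma homogeneous0 q : homogeneous q (0 : ext K n).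
Proof. by move=> I _; rewrite ext0. Qed.

Lemma homogeneousD q a b :
  homogeneous q a -> homogeneous q b -> homogeneous q (a + b).
Proof. by move=> ha hb I Iq; rewrite extD ha // hb // addr0. Qed.

Lemma homogeneousZ q (k : K) a : homogeneous q a -> homogeneous q (k *: a).
Proof. by move=> ha I Iq; rewrite extZ ha // mulr0. Qed.

Lemma homogeneous_sum q (T : Type) (r : seq T) (P : pred T) (F : T -> ext K n) :
  (forall t, P t -> homogeneous q (F t)) ->
  homogeneous q (\sum_(t <- r | P t) F t).
Proof.
move=> hF; elim/big_ind: _ => //; [exact: homogeneous0|exact: homogeneousD].
Qed.

Lemma homogeneousM p q a b :
  homogeneous p a -> homogeneous q b -> homogeneous (p + q) (a * b).
Proof.
move=> ha hb S Spq; rewrite extM big1 // => I _; rewrite big1 // => J /eqP IJS.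
have [Ip|/eqP Ip] := eqVneq #|I| p; last by rewrite ha // mulr0 mul0r.
have [Jq|/eqP Jq] := eqVneq #|J| q; last by rewrite hb // mulr0.
have [dIJ|nIJ] := eqVneq (I :&: J)%SET finset.set0.
  by case: Spq; rewrite -IJS cardsU dIJ cards0 subn0 Ip Jq.
by rewrite ext_sign_disj // !mul0r.
Qed.

(** The sign is that of [ext_signC]: exchanging dz_I and dz_J performs
    #|I| * #|J| transpositions of generators. *)
Lemma homogeneous_mulC p q a b : homogeneous p a -> homogeneous q b ->
  a * b = (-1) ^+ (p * q) *: (b * a).
Proof.
move=> ha hb; apply/ffunP => S; rewrite extZ !extM.
under eq_bigr do rewrite big_mkcond.
rewrite exchange_big /= mulr_sumr; apply: eq_bigr => J _.
rewrite mulr_sumr [RHS]big_mkcond /=; apply: eq_bigr => I _.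
rewrite finset.setUC; case: ifP => // _.
have [Ip|/eqP Ip] := eqVneq #|I| p; last by rewrite ha // !(mulr0, mul0r).
have [Jq|/eqP Jq] := eqVneq #|J| q; last by rewrite hb // !(mulr0, mul0r).
by rewrite ext_signC Ip Jq -!mulrA; congr (_ * (_ * _)); rewrite mulrC.
Qed.

Lemma homogeneous_dz (l : 'I_n) : homogeneous 1 (dz K l).
Proof.
by move=> I I1; rewrite ffunE; case: eqP I1 => // ->; rewrite cards1.
Qed.

End ExteriorAlgebra.

Section Pullback.
Variables (K : comNzRingType) (m n : nat).

Lemma enum_setU1_min (i : 'I_n) (I : {set 'I_n}) :
  (forall j : 'I_n, j \in I -> (i < j)%N) -> enum (i |: I) = i :: enum I.
Proof.
move=> iI.
have sE (B : {set 'I_n}) : sorted (fun u v : 'I_n => (u < v)%N) (enum B).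
  rewrite /enum_mem -enumT; apply: sorted_filter => [u v w|]; first exact: ltn_trans.
  rewrite -[sorted _ _]/(sorted (relpre val ltn) _) -sorted_map val_enum_ord.
  exact: iota_ltn_sorted.
apply: (@irr_sorted_eq _ (fun u v : 'I_n => (u < v)%N)) => //.
- by move=> u v w; exact: ltn_trans.
- by move=> u; exact: ltnn.
- rewrite /= path_min_sorted ?sE //.
  by apply/allP => j; rewrite mem_enum => /iI.
- by move=> j; rewrite inE !mem_enum !inE.
Qed.

(** Splitting off the least element keeps the factors of the ordered monomials
    in increasing order. *)
Lemma set_min_ind (P : {set 'I_n} -> Prop) :
  P finset.set0 ->
  (forall (i : 'I_n) (I : {set 'I_n}),
     (forall j : 'I_n, j \in I -> (i < j)%N) -> P I -> P (i |: I)%SET) ->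
  forall I, P I.
Proof.
move=> P0 PU I; move: {2}#|I| (leqnn #|I|) => k; elim: k I => [|k IH] I.
  by rewrite leqn0 cards_eq0 => /eqP ->.
have [->//|[i0 i0I] Ik] := set_0Vmem I.
case: (arg_minnP (fun i : 'I_n => i : nat) i0I) => i iI' imin.
have {iI'} iI : i \in I := iI'.
rewrite -(finset.setD1K iI); apply: PU => [j|].
  rewrite finset.in_setD1 => /andP[ji jI].
  by rewrite ltn_neqAle imin // andbT eq_sym.
by apply: IH; move: Ik; rewrite (cardsD1 i) iI.
Qed.

Variable t : 'I_n -> ext K m.
Hypothesis tN : forall i j, t i * t j = - (t j * t i).
Hypothesis tt : forall i, t i * t i = 0.

Definition monomial (I : {set 'I_n}) : ext K m := \prod_(i <- enum I) t i.

Lemma monomialU1 (i : 'I_n) (I : {set 'I_n}) :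
  (forall j : 'I_n, j \in I -> (i < j)%N) -> monomial (i |: I) = t i * monomial I.
Proof. by move=> iI; rewrite /monomial enum_setU1_min // big_cons. Qed.

Lemma ext_sign1l (i : 'I_n) (J : {set 'I_n}) :
  ext_sign K [set i]%SET J = \prod_(j in J) sign1 K i j.
Proof. by rewrite /ext_sign big_set1. Qed.

Lemma ext_sign1_min (i : 'I_n) (J : {set 'I_n}) :
  (forall j : 'I_n, j \in J -> (i < j)%N) -> ext_sign K [set i]%SET J = 1.
Proof.
by move=> iJ; rewrite ext_sign1l big1 // => j jJ; rewrite /sign1 iJ.
Qed.

(** Moving the new factor to its place in the increasing order passes one
    factor for each smaller index, with one sign each. *)
Lemma mul_monomial1 (i : 'I_n) (J : {set 'I_n}) :
  t i * monomial J = ext_sign K [set i]%SET J *: monomial (i |: J).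
Proof.
elim/set_min_ind: J => [|j J jJ IH].
  by rewrite ext_sign0r scale1r -monomialU1 // => j; rewrite inE.
have [ij|ji|/val_inj ->] := ltngtP i j.
- have iJ k : k \in (j |: J)%SET -> (i < k)%N.
    by rewrite !inE => /orP[/eqP->//|/jJ]; exact: ltn_trans.
  by rewrite (ext_sign1_min iJ) scale1r (monomialU1 iJ).
- rewrite monomialU1 // mulrA tN mulNr -mulrA IH -scalerAr.
  rewrite finset.setUCA [in RHS]monomialU1; last first.
    by move=> k; rewrite !inE => /orP[/eqP->//|/jJ].
  rewrite ext_signUr; last first.
    apply/finset.setP => k; rewrite !inE; case: eqP => //= ->.
    by apply/negP => /jJ; rewrite ltnn.
  rewrite (ext_sign1l i [set j]%SET) big_set1 /sign1 ltnNge (ltnW ji) ji /=.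
  by rewrite mulN1r scaleNr.
- rewrite (monomialU1 jJ) mulrA tt mul0r ext_sign_disj ?scale0r //.
  by apply/set0Pn; exists j; rewrite !inE eqxx.
Qed.

(** Anticommuting elements of square zero multiply as the generators dz_i do;
    this is the universal property of the exterior algebra on monomials. *)
Lemma mul_monomial (I J : {set 'I_n}) :
  monomial I * monomial J = ext_sign K I J *: monomial (I :|: J).
Proof.
elim/set_min_ind: I => [|i I iI IH].
  by rewrite /monomial enum_set0 big_nil mul1r ext_sign0l scale1r finset.set0U.
have iNI : ([set i] :&: I)%SET = finset.set0.
  apply/finset.setP => k; rewrite !inE; case: eqP => //= ->.
  by apply/negP => /iI; rewrite ltnn.
rewrite monomialU1 // -mulrA IH -scalerAr mul_monomial1 scalerA finset.setUA.
rewrite ext_signUl //.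
have [dIJ|nIJ] := eqVneq (I :&: J)%SET finset.set0; last first.
  by rewrite (ext_sign_disj _ nIJ) mul0r mulr0.
by rewrite ext_signUr // (ext_sign1_min iI) mul1r mulrC.
Qed.

End Pullback.

Section PullbackMorphism.
Variables (K : numFieldType) (m n : nat) (Jac : 'M[K]_(m, n)).
Implicit Types a b : ext K n.

Lemma pullback_is_linear : linear (pullback Jac).
Proof.
move=> k a b; rewrite /pullback scaler_sumr -big_split /=; apply: eq_bigr => I _.
by rewrite extD extZ scalerDl scalerA.
Qed.

HB.instance Definition _ :=
  GRing.isLinear.Build K (ext K n) (ext K m) _ (pullback Jac) pullback_is_linear.

Let t (k : 'I_n) : ext K m := \sum_(l < m) Jac l k *: dz K l.

Let tN i j : t i * t j = - (t j * t i).
Proof.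
have th k : homogeneous 1 (t k).
  by apply: homogeneous_sum => l _; apply/homogeneousZ/homogeneous_dz.
by rewrite (homogeneous_mulC (th i) (th j)) expr1 scaleN1r.
Qed.

Let tt i : t i * t i = 0.
Proof.
(* Anticommutation only gives 2 t_i^2 = 0; the scalars have characteristic 0. *)
apply/ffunP => S; apply/eqP; rewrite ext0 -[_ == 0](mulrn_eq0 _ 2) mulr2n.
by rewrite -extD {1}tN addNr ext0.
Qed.

(** Both sides are bilinear, so it suffices to compare them on the monomials
    dz_I, which [pullback] sends to ordered products of the images of the
    generators; these images anticommute, being of degree one. *)
Lemma pullbackM a b : pullback Jac (a * b) = pullback Jac a * pullback Jac b.
Proof.
have E c : pullback Jac c = \sum_I c I *: monomial t I by [].
rewrite !E mulr_suml.
under [LHS]eq_bigr => S _ do rewrite extM scaler_suml.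
rewrite exchange_big /=; apply: eq_bigr => I _.
under eq_bigr => S _ do rewrite scaler_suml.
rewrite (exchange_big_dep xpredT) //= mulr_sumr; apply: eq_bigr => J _.
rewrite (big_pred1 (I :|: J)%SET) => [|S]; last by rewrite eq_sym.
rewrite -!ext_scalerAl -!ext_scalerAr (mul_monomial tN tt) !scalerA.
by congr (_ *: _); rewrite -mulrA mulrC.
Qed.

End PullbackMorphism.

(** * Traces of words in odd letters *)

(** The letters are elements of a noncommutative ring of matrices of forms, and
    phi is a scalar coefficient of the trace. The ring and the functional are
    kept abstract; all that matters is the sign of a rotation of a word in
    letters of odd degree. *)
Section CyclicWords.
Variables (B : pzRingType) (K : numFieldType) (phi : {additive B -> K}).
Variable odd1 : B -> Prop.
Hypothesis cyc4 : forall x y z t, odd1 x -> odd1 y -> odd1 z -> odd1 t ->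
  phi (x * y * z * t) = - phi (y * z * t * x).
Hypothesis cyc5 : forall x y z t u,
  odd1 x -> odd1 y -> odd1 z -> odd1 t -> odd1 u ->
  phi (x * y * z * t * u) = phi (y * z * t * u * x).
Hypothesis cyc6 : forall x, odd1 x ->
  phi (x * x * x * x * x * x) = - phi (x * x * x * x * x * x).

(** Graded Leibniz rule for a product of odd letters x, y, z, t, u whose
    derivatives are x', y', z', t', u'. *)
Definition der2 (x x' y y' : B) := x' * y - x * y'.
Definition der3 (x x' y y' z z' : B) := der2 x x' y y' * z + x * y * z'.
Definition der4 (x x' y y' z z' t t' : B) :=
  der3 x x' y y' z z' * t - x * y * z * t'.
Definition der5 (x x' y y' z z' t t' u u' : B) :=
  der4 x x' y y' z z' t t' * u + x * y * z * t * u'.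

(** Every term of the derivative is a multiple of the word A^6, and rotating an
    odd letter past five others shows that its trace is its own opposite. *)
Lemma der5_pow A : odd1 A -> let A' := - (A * A) in
  phi (der5 A A' A A' A A' A A' A A') = 0.
Proof.
move=> oA A'; have w6 : phi (A * A * A * A * A * A) = 0.
  apply/eqP; rewrite -[_ == 0](mulrn_eq0 _ 2) mulr2n.
  by rewrite {1}cyc6 // addNr.
rewrite /der5 /der4 /der3 /der2 /A' !(@mulrN B, @mulNr B) !(@mulrDl B).
rewrite !(@mulrN B, @mulNr B) !opprK !mulrA.
by rewrite !(raddfD phi, raddfN phi) !w6 !(oppr0, addr0).
Qed.

(** The words A^5 and Z^5 are fixed by rotation; the other thirty words fall
    into six classes of five, and rotating a word of odd length costs no sign. *)
Lemma phi_pow5 A Z : odd1 A -> odd1 Z ->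
  phi ((A + Z) * (A + Z) * (A + Z) * (A + Z) * (A + Z)) =
  phi (A * A * A * A * A) + phi (Z * Z * Z * Z * Z)
  + 5 * (phi (A * A * A * A * Z) + phi (A * A * A * Z * Z)
    + phi (A * A * Z * A * Z) + phi (A * A * Z * Z * Z)
    + phi (A * Z * A * Z * Z) + phi (A * Z * Z * Z * Z)).
Proof.
move=> oA oZ; rewrite !(@mulrDr B) !(@mulrDl B) !(raddfD phi).
(* One rewrite for each rotation class, from the words furthest from the
   chosen representative to the nearest. *)
rewrite (cyc5 oA oA oA oZ oA) (cyc5 oA oA oZ oA oA) (cyc5 oA oZ oA oA oA)
  (cyc5 oZ oA oA oA oA).
rewrite (cyc5 oA oA oZ oZ oA) (cyc5 oA oZ oZ oA oA) (cyc5 oZ oZ oA oA oA)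
  (cyc5 oZ oA oA oA oZ).
rewrite (cyc5 oA oZ oA oZ oA) (cyc5 oZ oA oZ oA oA) (cyc5 oA oZ oA oA oZ)
  (cyc5 oZ oA oA oZ oA).
rewrite (cyc5 oA oZ oZ oZ oA) (cyc5 oZ oZ oZ oA oA) (cyc5 oZ oZ oA oA oZ)
  (cyc5 oZ oA oA oZ oZ).
rewrite (cyc5 oZ oA oZ oZ oA) (cyc5 oA oZ oZ oA oZ) (cyc5 oZ oZ oA oZ oA)
  (cyc5 oZ oA oZ oA oZ).
rewrite (cyc5 oZ oZ oZ oZ oA) (cyc5 oZ oZ oZ oA oZ) (cyc5 oZ oZ oA oZ oZ)
  (cyc5 oZ oA oZ oZ oZ).
ring.
Qed.

Ltac expand_words :=
  rewrite ?(@mulrN B, @mulNr B) ?(@mulrDl B, @mulrDr B) ?(@mulrN B, @mulNr B)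
    ?(@mulrDl B, @mulrDr B) ?(@mulrN B, @mulNr B) ?mulrA
    ?(raddfD phi, raddfN phi).

Definition rho_phi A Z : K :=
  - 4^-1 * phi (A * Z * A * Z) + 2^-1 * phi (A * A * Z * Z)
  - 2^-1 * phi (A * A * A * Z) - 2^-1 * phi (A * Z * Z * Z).

(** The derivative of [rho_phi A Z], given derivatives A' and Z' of the letters. *)
Definition rho_der (A A' Z Z' : B) : K :=
  - 4^-1 * phi (der4 A A' Z Z' A A' Z Z') + 2^-1 * phi (der4 A A' A A' Z Z' Z Z')
  - 2^-1 * phi (der4 A A' A A' A A' Z Z') - 2^-1 * phi (der4 A A' Z Z' Z Z' Z Z').

(** The derivative of rho cancels the mixed words of the fifth power of A + Z:
    the coefficients add up to zero on each of the six mixed rotation classes. *)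
Lemma rho_der_pow5 A Z : odd1 A -> odd1 Z ->
  let A' := - (A * A) in let Z' := - (A * Z + Z * A + Z * Z) in
  - 10^-1 * phi (Z * Z * Z * Z * Z)
  + 10^-1 * phi ((A + Z) * (A + Z) * (A + Z) * (A + Z) * (A + Z))
  - 10^-1 * phi (A * A * A * A * A) + rho_der A A' Z Z' = 0.
Proof.
move=> oA oZ A' Z'; rewrite phi_pow5 // /rho_der /der4 /der3 /der2 /A' /Z'.
expand_words.
rewrite (cyc5 oA oA oA oZ oA) (cyc5 oA oA oZ oA oA) (cyc5 oA oZ oA oA oA)
  (cyc5 oZ oA oA oA oA).
rewrite (cyc5 oA oA oZ oZ oA) (cyc5 oA oZ oZ oA oA) (cyc5 oZ oZ oA oA oA)
  (cyc5 oZ oA oA oA oZ).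
rewrite (cyc5 oA oZ oA oZ oA) (cyc5 oZ oA oZ oA oA) (cyc5 oA oZ oA oA oZ)
  (cyc5 oZ oA oA oZ oA).
rewrite (cyc5 oA oZ oZ oZ oA) (cyc5 oZ oZ oZ oA oA) (cyc5 oZ oZ oA oA oZ)
  (cyc5 oZ oA oA oZ oZ).
rewrite (cyc5 oA oZ oZ oA oZ) (cyc5 oZ oZ oA oZ oA) (cyc5 oZ oA oZ oA oZ).
by field.
Qed.

(** A rotation of a word of length four changes its sign, so the
    words surviving in the alternating sum of rho are, up to rotation, AAZY,
    AZYY and AZYZ, which are those of the derivative of the word AZY. *)
Lemma rho_tr3 A Z Y : odd1 A -> odd1 Z -> odd1 Y ->
  let A' := - (A * A) in let Z' := - (A * Z + Z * A + Z * Z) in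
  let Y' := - ((A + Z) * Y + Y * (A + Z) + Y * Y) in
  rho_phi Z Y - rho_phi (A + Z) Y + rho_phi A (Z + Y) - rho_phi A Z
  - phi (der3 A A' Z Z' Y Y') = 0.
Proof.
move=> oA oZ oY A' Z' Y'; rewrite /rho_phi /der3 /der2 /A' /Z' /Y'.
expand_words.
rewrite (cyc4 oA oZ oY oA) (cyc4 oZ oY oA oA) (cyc4 oY oA oA oZ).
rewrite (cyc4 oZ oA oA oY) (cyc4 oZ oA oY oY) (cyc4 oZ oA oZ oY).
rewrite (cyc4 oZ oY oA oY) (cyc4 oY oA oY oZ) (cyc4 oA oZ oA oY) (cyc4 oZ oA oY oA).
rewrite (cyc4 oZ oZ oA oY) (cyc4 oZ oA oY oZ).
by field.
Qed.

Lemma phi_tr3_cocycle A Z Y T :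
  phi (Z * Y * T) - phi ((A + Z) * Y * T) + phi (A * (Z + Y) * T)
  - phi (A * Z * (Y + T)) + phi (A * Z * Y) = 0.
Proof. by rewrite !(@mulrDl B, @mulrDr B) !(raddfD phi); ring. Qed.

End CyclicWords.

(** * Matrices over the exterior algebra *)

Lemma square_addB (B : pzRingType) (p z : B) :
  p * p - (p + z) * (p + z) = - (p * z + z * p + z * z).
Proof.
rewrite mulrDl !mulrDr -!addrA; set t := p * z + _.
by rewrite opprD addrA subrr add0r /t !addrA.
Qed.

Lemma square_difference (B : pzRingType) (w p q : B) :
  - (p * p) + q * q + w * (p - q) + (p - q) * w =
  (q - w) * (q - w) - (p - w) * (p - w).
Proof.
have sqE x : (x - w) * (x - w) = x * x - (x * w + w * x) + w * w.
  by rewrite mulrBl !mulrBr opprB opprD !addrA addrAC.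
rewrite !sqE.
have zmodE (pp qq ps qs ww : B) :
  qq - qs + ww - (pp - ps + ww) = - pp + qq + (ps - qs).
  by rewrite opprD addrACA subrr addr0 opprB [ps - pp]addrC addrACA
    [qq - _]addrC [- qs + _]addrC.
rewrite zmodE -addrA mulrBr mulrBl [w * p - _ + _]addrACA -opprD.
by rewrite [w * p + _]addrC [w * q + _]addrC.
Qed.

Section GradedTrace.
Variables (K : comNzRingType) (n : nat).

Definition homogeneous_mx q r s (M : 'M[ext K n]_(r, s)) : Prop :=
  forall k l, homogeneous q (M k l).

Lemma homogeneous_mxM p q r s t (M : 'M[ext K n]_(r, s)) (N : 'M[ext K n]_(s, t)) :
  homogeneous_mx p M -> homogeneous_mx q N -> homogeneous_mx (p + q) (M *m N).
Proof.
move=> hM hN k l; rewrite mxE; apply: homogeneous_sum => j _.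
exact: homogeneousM.
Qed.

Lemma signr_scale p (a : ext K n) : ((-1) ^+ p : K) *: a = (-1) ^+ p * a.
Proof. by rewrite -signr_odd -[in RHS]signr_odd scaler_sign mulr_sign. Qed.

(** The trace is cyclic up to the sign by which the entries commute. *)
Lemma mxtrace_graded p q r s (M : 'M[ext K n]_(r, s)) (N : 'M[ext K n]_(s, r)) :
  homogeneous_mx p M -> homogeneous_mx q N ->
  \tr (M *m N) = (-1) ^+ (p * q) * \tr (N *m M).
Proof.
move=> hM hN; rewrite /mxtrace mulr_sumr; under eq_bigr do rewrite mxE.
rewrite exchange_big /=; apply: eq_bigr => j _; rewrite mxE mulr_sumr.
by apply: eq_bigr => k _; rewrite (homogeneous_mulC (hM k j) (hN j k)) signr_scale.
Qed.

Variable r : nat.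
Implicit Types M N : 'M[ext K n]_r.

Lemma mx_leibnizE p M M' N N' k l :
  (M' * N + (-1) ^+ p *: (M * N')) k l =
  \sum_j (M' k j * N j l + ((-1) ^+ p : K) *: (M k j * N' j l)).
Proof.
rewrite !mxE mulr_sumr -big_split /=; apply: eq_bigr => j _.
by rewrite signr_scale.
Qed.

(** With D M = DM + W M - (-1)^p M W, this is the graded Leibniz rule for D: the
    terms with W between M and N cancel. *)
Lemma cov_leibniz p q (W M N DM DN : 'M[ext K n]_r) :
  DM * N + (-1) ^+ p *: (M * DN) + W * (M * N) - (-1) ^+ (p + q) *: (M * N * W) =
  (DM + W * M - (-1) ^+ p *: (M * W)) * N
  + (-1) ^+ p *: (M * (DN + W * N - (-1) ^+ q *: (N * W))).
Proof.
have mul_sgn e (P Q : 'M[ext K n]_r) : P * ((-1) ^+ e *: Q) = (-1) ^+ e *: (P * Q).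
  by rewrite -signr_odd !scaler_sign; case: odd; rewrite ?mulrN.
have sgn_mul e (P Q : 'M[ext K n]_r) : (-1) ^+ e *: P * Q = (-1) ^+ e *: (P * Q).
  by rewrite -signr_odd !scaler_sign; case: odd; rewrite ?mulNr.
rewrite mulrBl mulrDl mulrBr mulrDr mul_sgn sgn_mul scalerBr scalerDr scalerA.
rewrite -exprD !mulrA.
have zmodE (a b c d e : 'M[ext K n]_r) : a + b + c - d = (a + c - e) + (b + e - d).
  by rewrite (addrC b e) !addrA subrK (addrAC a c b).
exact: zmodE.
Qed.

(** The value of D (P - Q) when dP = - P^2 and dQ = - Q^2: the flat connections
    P and Q enter only through their differences with W. *)
Lemma cov_difference (W P Q : 'M[ext K n]_r) :
  - (P * P) - - (Q * Q) + W * (P - Q) - (-1) ^+ 1 *: ((P - Q) * W) =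
  (Q - W) * (Q - W) - (P - W) * (P - W).
Proof. by rewrite expr1 scaleN1r (opprK (Q * Q)) opprK square_difference. Qed.

Lemma cov_square_addB (P Z : 'M[ext K n]_r) :
  P * P - (P + Z) * (P + Z) = - (P * Z + Z * P + Z * Z).
Proof. exact: square_addB. Qed.

(** Coefficients of a trace are scalars, which makes identities between traces
    accessible to computation in a commutative field. *)
Definition trace_coef (S : {set 'I_n}) M : K := (\tr M) S.

Lemma trace_coef_is_additive S : zmod_morphism (trace_coef S).
Proof. by move=> M N; rewrite /trace_coef raddfB extD extN. Qed.

HB.instance Definition _ S :=
  GRing.isZmodMorphism.Build 'M[ext K n]_r K (trace_coef S)
    (trace_coef_is_additive S).

Lemma trace_coef_rot S p M N : homogeneous_mx 1 M -> homogeneous_mx p N ->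
  trace_coef S (M * N) = (-1) ^+ p * trace_coef S (N * M).
Proof.
move=> hM hN; rewrite /trace_coef -!mulmxE (mxtrace_graded hM hN) mul1n.
by rewrite -signr_scale extZ.
Qed.

Lemma trace_coef_rot4 S (x y z t : 'M[ext K n]_r) :
  homogeneous_mx 1 x -> homogeneous_mx 1 y -> homogeneous_mx 1 z ->
  homogeneous_mx 1 t ->
  trace_coef S (x * y * z * t) = - trace_coef S (y * z * t * x).
Proof.
move=> hx hy hz ht.
have -> : x * y * z * t = x * (y * z * t) by rewrite !mulrA.
have h := homogeneous_mxM (homogeneous_mxM hy hz) ht.
by rewrite (trace_coef_rot _ hx h) -signr_odd expr1 mulN1r.
Qed.

Lemma trace_coef_rot5 S (x y z t u : 'M[ext K n]_r) :
  homogeneous_mx 1 x -> homogeneous_mx 1 y -> homogeneous_mx 1 z ->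
  homogeneous_mx 1 t -> homogeneous_mx 1 u ->
  trace_coef S (x * y * z * t * u) = trace_coef S (y * z * t * u * x).
Proof.
move=> hx hy hz ht hu.
have -> : x * y * z * t * u = x * (y * z * t * u) by rewrite !mulrA.
have h := homogeneous_mxM (homogeneous_mxM (homogeneous_mxM hy hz) ht) hu.
by rewrite (trace_coef_rot _ hx h) -signr_odd expr0 mul1r.
Qed.

Lemma trace_coef_rot6 S (x : 'M[ext K n]_r) : homogeneous_mx 1 x ->
  trace_coef S (x * x * x * x * x * x) = - trace_coef S (x * x * x * x * x * x).
Proof.
move=> hx; have -> : x * x * x * x * x * x = x * (x * x * x * x * x).
  by rewrite !mulrA.
have h := homogeneous_mxM (homogeneous_mxM (homogeneous_mxM (homogeneous_mxM
  hx hx) hx) hx) hx.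
by rewrite {1}(trace_coef_rot _ hx h) -signr_odd expr1 mulN1r !mulrA.
Qed.

End GradedTrace.

Section ScalarConjugation.
Variables (K : comNzRingType) (n : nat).

Definition scal_mx r s (M : 'M[K]_(r, s)) : 'M[ext K n]_(r, s) :=
  map_mx (in_alg (ext K n)) M.

Definition conj_mx r s (h : 'M[K]_(s, r)) (g : 'M[K]_(r, s))
    (M : 'M[ext K n]_r) : 'M[ext K n]_s := scal_mx h *m M *m scal_mx g.

Lemma conj_mxE r s (h : 'M[K]_(s, r)) (g : 'M[K]_(r, s)) (M : 'M[ext K n]_r) k l :
  conj_mx h g M k l = \sum_j \sum_m (h k m * g j l) *: M m j.
Proof.
rewrite mxE; apply: eq_bigr => j _; rewrite mxE mulr_suml; apply: eq_bigr => m _.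
by rewrite !mxE /= mulr_algl -ext_scalerAl -ext_scalerAr mulr1 scalerA.
Qed.

Lemma conj_mxM r s (h : 'M[K]_(s, r)) (g : 'M[K]_(r, s)) (M N : 'M[ext K n]_r) :
  g *m h = 1%:M -> conj_mx h g M * conj_mx h g N = conj_mx h g (M * N).
Proof.
move=> gh; rewrite /conj_mx -!mulmxE -!mulmxA.
rewrite (mulmxA (scal_mx g)) /scal_mx -map_mxM gh map_mx1 mul1mx.
by rewrite !mulmxA.
Qed.

(** Scalars are central in the exterior algebra, so the trace is cyclic for a
    product with a scalar factor although the entries do not commute. *)
Lemma mxtrace_conj r s (h : 'M[K]_(s, r)) (g : 'M[K]_(r, s)) (M : 'M[ext K n]_r) :
  g *m h = 1%:M -> \tr (conj_mx h g M) = \tr M.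
Proof.
move=> gh; rewrite {1}/mxtrace.
under eq_bigr => k _ do rewrite conj_mxE exchange_big /=.
rewrite exchange_big; apply: eq_bigr => m _; rewrite exchange_big (bigD1 m) //=.
have E j : \sum_i (h i m * g j i) *: M m j = (j == m)%:R *: M m j.
  rewrite -scaler_suml; congr (_ *: _).
  have := congr1 (fun P : 'M[K]_r => P j m) gh; rewrite !mxE => <-.
  by apply: eq_bigr => i _; rewrite mulrC.
rewrite E eqxx scale1r big1 ?addr0 // => j jm.
by rewrite E (negPf jm) scale0r.
Qed.

End ScalarConjugation.

Section TraceIdentities.
Variables (K : numClosedFieldType) (n r : nat).
Implicit Types A Z Y T : 'M[ext K n]_r.

Definition pow5_mx A : ext K n := - 10^-1 *: \tr (A * A * A * A * A).

Definition rho_mx A Z : ext K n :=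
  - 4^-1 *: \tr (A * Z * A * Z) + 2^-1 *: \tr (A * A * Z * Z)
  - 2^-1 *: \tr (A * A * A * Z) - 2^-1 *: \tr (A * Z * Z * Z).

(** The differential of [rho_mx A Z] when A' and Z' are the covariant derivatives
    of A and Z. *)
Definition drho_mx (A A' Z Z' : 'M[ext K n]_r) : ext K n :=
  - 4^-1 *: \tr (der4 A A' Z Z' A A' Z Z')
  + 2^-1 *: \tr (der4 A A' A A' Z Z' Z Z')
  - 2^-1 *: \tr (der4 A A' A A' A A' Z Z')
  - 2^-1 *: \tr (der4 A A' Z Z' Z Z' Z Z').

Let phi (S : {set 'I_n}) : {additive 'M[ext K n]_r -> K} := @trace_coef K n r S.

Let lin4E (c1 c2 c3 c4 : K) (t1 t2 t3 t4 : ext K n) S :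
  (c1 *: t1 + c2 *: t2 - c3 *: t3 - c4 *: t4) S =
  c1 * t1 S + c2 * t2 S - c3 * t3 S - c4 * t4 S.
Proof. by rewrite !(extD, extN, extZ). Qed.

Let rho_mxE A Z S : rho_mx A Z S = rho_phi (phi S) A Z.
Proof. exact: lin4E. Qed.

Let drho_mxE A A' Z Z' S : drho_mx A A' Z Z' S = rho_der (phi S) A A' Z Z'.
Proof. exact: lin4E. Qed.

Let pow5_mxE A S : pow5_mx A S = - 10^-1 * phi S (A * A * A * A * A).
Proof. exact: extZ. Qed.

Lemma tr_der5 A : homogeneous_mx 1 A -> let A' := - (A * A) in
  \tr (der5 A A' A A' A A' A A' A A') = 0.
Proof.
move=> hA A'; apply: eq_ext => S; rewrite ext0.
exact: (@der5_pow _ K (phi S) _ (@trace_coef_rot6 K n r S)).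
Qed.

Lemma pow5_rho A Z : homogeneous_mx 1 A -> homogeneous_mx 1 Z ->
  pow5_mx Z - pow5_mx (A + Z) + pow5_mx A
  + drho_mx A (- (A * A)) Z (- (A * Z + Z * A + Z * Z)) = 0.
Proof.
move=> hA hZ; apply: eq_ext => S.
have sumE (t1 t2 t3 t4 : ext K n) : (t1 - t2 + t3 + t4) S = t1 S - t2 S + t3 S + t4 S.
  by rewrite !(extD, extN).
rewrite sumE !pow5_mxE drho_mxE ext0.
have := @rho_der_pow5 _ K (phi S) _ (@trace_coef_rot5 K n r S) A Z hA hZ.
by move=> /= <-; rewrite -!mulNr opprK.
Qed.

Lemma rho_tr A Z Y :
  homogeneous_mx 1 A -> homogeneous_mx 1 Z -> homogeneous_mx 1 Y ->
  rho_mx Z Y - rho_mx (A + Z) Y + rho_mx A (Z + Y) - rho_mx A Z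
  - \tr (der3 A (- (A * A)) Z (- (A * Z + Z * A + Z * Z))
       Y (- ((A + Z) * Y + Y * (A + Z) + Y * Y))) = 0.
Proof.
move=> hA hZ hY; apply: eq_ext => S.
have sumE (t1 t2 t3 t4 t5 : ext K n) (v1 v2 v3 v4 : K) :
    t1 S = v1 -> t2 S = v2 -> t3 S = v3 -> t4 S = v4 ->
    (t1 - t2 + t3 - t4 - t5) S = v1 - v2 + v3 - v4 - t5 S.
  by move=> <- <- <- <-; rewrite !(extD, extN).
apply: etrans (sumE _ _ _ _ _ _ _ _ _ (rho_mxE Z Y S) (rho_mxE (A + Z) Y S)
  (rho_mxE A (Z + Y) S) (rho_mxE A Z S)) _.
rewrite ext0.
exact: (@rho_tr3 _ K (phi S) _ (@trace_coef_rot4 K n r S) A Z Y hA hZ hY).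
Qed.

Lemma tr3_cocycle A Z Y T :
  \tr (Z * Y * T) - \tr ((A + Z) * Y * T) + \tr (A * (Z + Y) * T)
  - \tr (A * Z * (Y + T)) + \tr (A * Z * Y) = 0.
Proof.
apply: eq_ext => S.
have sumE (t1 t2 t3 t4 t5 : ext K n) :
  (t1 - t2 + t3 - t4 + t5) S = t1 S - t2 S + t3 S - t4 S + t5 S.
  by rewrite !(extD, extN).
rewrite ext0; apply: etrans (sumE _ _ _ _ _) _.
exact: (phi_tr3_cocycle (phi S) A Z Y T).
Qed.

Variables (s : nat) (h : 'M[K]_(s, r)) (g : 'M[K]_(r, s)).
Hypothesis gh : g *m h = 1%:M.

Lemma pow5_mx_conj A :
  - 10^-1 *: \tr (conj_mx h g A * conj_mx h g A * conj_mx h g A * conj_mx h g A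
                  * conj_mx h g A) = pow5_mx A.
Proof. by rewrite !conj_mxM // mxtrace_conj. Qed.

Lemma tr3_conj A Z Y :
  \tr (conj_mx h g A * conj_mx h g Z * conj_mx h g Y) = \tr (A * Z * Y).
Proof. by rewrite !conj_mxM // mxtrace_conj. Qed.

Lemma tr4_conj A Z Y T :
  \tr (conj_mx h g A * conj_mx h g Z * conj_mx h g Y * conj_mx h g T) =
  \tr (A * Z * Y * T).
Proof. by rewrite !conj_mxM // mxtrace_conj. Qed.

End TraceIdentities.

Lemma rho_mx_conj (K : numClosedFieldType) (n r s : nat) (h : 'M[K]_(s, r))
    (g : 'M[K]_(r, s)) (A Z : 'M[ext K n]_r) :
  g *m h = 1%:M -> rho_mx (conj_mx h g A) (conj_mx h g Z) = rho_mx A Z.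
Proof.
move=> gh.
have combE (t1 t2 t3 t4 u1 u2 u3 u4 : ext K n) :
    t1 = u1 -> t2 = u2 -> t3 = u3 -> t4 = u4 ->
    - 4^-1 *: t1 + 2^-1 *: t2 - 2^-1 *: t3 - 2^-1 *: t4 =
    - 4^-1 *: u1 + 2^-1 *: u2 - 2^-1 *: u3 - 2^-1 *: u4.
  by move=> -> -> -> ->.
exact: (combE _ _ _ _ _ _ _ _ (tr4_conj gh A Z A Z) (tr4_conj gh A A Z Z)
  (tr4_conj gh A A A Z) (tr4_conj gh A Z Z Z)).
Qed.

(** * Differential forms on a complex manifold *)

Section DerivativeOfSums.
Variables (F : numFieldType) (V : normedModType F).

Lemma differentiable_bigsum (T : Type) (r : seq T) (P : pred T)
    (f : T -> V -> F) (x : V) :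
  (forall t, differentiable (f t) x) ->
  differentiable (fun z => \sum_(t <- r | P t) f t z) x.
Proof.
move=> df; elim: r => [|t r IH].
  by under eq_fun do rewrite big_nil; exact: differentiable_cst.
under eq_fun do rewrite big_cons; case: (P t) => //.
exact: differentiableD.
Qed.

Lemma derive_bigsum (T : Type) (r : seq T) (P : pred T)
    (f : T -> V -> F) (x v : V) :
  (forall t, differentiable (f t) x) ->
  'D_v (fun z => \sum_(t <- r | P t) f t z) x = \sum_(t <- r | P t) 'D_v (f t) x.
Proof.
move=> df; elim: r => [|t r IH].
  by under eq_fun do rewrite big_nil; rewrite big_nil derive_cst.
under eq_fun do rewrite big_cons; rewrite big_cons; case: (P t) => //.
rewrite -IH; apply: deriveD; apply: diff_derivable => //.
exact: differentiable_bigsum.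
Qed.

End DerivativeOfSums.

Section FormValuedMaps.
Variables (K : numFieldType) (V : normedModType K) (n : nat).
Implicit Types (f g : V -> ext K n) (x v : V).

Definition smooth f x : Prop :=
  forall I : {set 'I_n}, differentiable (fun z => f z I : K) x.

Definition partial f x v : ext K n :=
  [ffun I : {set 'I_n} => 'D_v (fun z => f z I : K) x].

Lemma smooth_cst a x : smooth (fun=> a) x.
Proof. by move=> I; exact: differentiable_cst. Qed.

Lemma smoothD f g x : smooth f x -> smooth g x -> smooth (fun z => f z + g z) x.
Proof.
move=> sf sg I; under eq_fun do rewrite extD.
exact: (differentiableD (sf I) (sg I)).
Qed.

Lemma smoothZ (k : K) f x : smooth f x -> smooth (fun z => k *: f z) x.
Proof.
move=> sf I; under eq_fun do rewrite extZ.
exact: (differentiableZ k (sf I)).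
Qed.

Lemma smooth_sum (T : Type) (r : seq T) (f : T -> V -> ext K n) x :
  (forall t, smooth (f t) x) -> smooth (fun z => \sum_(t <- r) f t z) x.
Proof.
move=> sf I; under eq_fun do rewrite ext_sum.
by apply: differentiable_bigsum => t; exact: sf.
Qed.

Let term f g (I J : {set 'I_n}) z : K := ext_sign K I J * f z I * g z J.

Let differentiable_term f g I J x :
  smooth f x -> smooth g x -> differentiable (term f g I J) x.
Proof.
move=> sf sg; apply: differentiableM (sg J).
exact: differentiableM (differentiable_cst (ext_sign K I J) x) (sf I).
Qed.

Lemma smoothM f g x : smooth f x -> smooth g x -> smooth (fun z => f z * g z) x.
Proof.
move=> sf sg S; under eq_fun do rewrite extM.
apply: differentiable_bigsum => I; apply: differentiable_bigsum => J.
exact: (differentiable_term I J sf sg).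
Qed.

Lemma partial_cst a x v : partial (fun=> a) x v = 0.
Proof. by apply: eq_ext => I; rewrite ffunE ext0; exact: derive_cst. Qed.

Lemma partialD f g x v : smooth f x -> smooth g x ->
  partial (fun z => f z + g z) x v = partial f x v + partial g x v.
Proof.
move=> sf sg; apply: eq_ext => I; rewrite extD !ffunE.
under eq_fun do rewrite extD.
by apply: deriveD; apply: diff_derivable; [exact: sf|exact: sg].
Qed.

Lemma partialZ (k : K) f x v : smooth f x ->
  partial (fun z => k *: f z) x v = k *: partial f x v.
Proof.
move=> sf; apply: eq_ext => I; rewrite extZ !ffunE.
under eq_fun do rewrite extZ.
by apply: deriveZ; apply: diff_derivable; exact: sf.
Qed.

Lemma partial_sum (T : Type) (r : seq T) (f : T -> V -> ext K n) x v :
  (forall t, smooth (f t) x) ->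
  partial (fun z => \sum_(t <- r) f t z) x v = \sum_(t <- r) partial (f t) x v.
Proof.
move=> sf; apply: eq_ext => I; rewrite ext_sum ffunE.
under eq_fun do rewrite ext_sum.
rewrite derive_bigsum => [|t]; last exact: sf.
by apply: eq_bigr => t _; rewrite ffunE.
Qed.

Lemma partialM f g x v : smooth f x -> smooth g x ->
  partial (fun z => f z * g z) x v = partial f x v * g x + f x * partial g x v.
Proof.
move=> sf sg; apply: eq_ext => S; rewrite extD !extM -big_split /= ffunE.
under eq_fun do rewrite extM.
rewrite derive_bigsum => [|I]; last first.
  by apply: differentiable_bigsum => J; exact: (differentiable_term I J sf sg).
apply: eq_bigr => I _; rewrite derive_bigsum => [|J]; last first.
  exact: (differentiable_term I J sf sg).
rewrite -big_split /=; apply: eq_bigr => J _; rewrite !ffunE.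
have df : derivable (fun z => f z I : K) x v := diff_derivable (sf I).
have dg : derivable (fun z => g z J : K) x v := diff_derivable (sg J).
have dc : derivable (cst (ext_sign K I J)) x v by exact: derivable_cst.
rewrite (deriveM (derivableM dc df) dg) (deriveM dc df) derive_cst scaler0 addr0.
by rewrite addrC; congr (_ + _); exact: mulrC.
Qed.

Lemma eq_near_partial f g x v :
  (\forall z \near x, f z = g z) -> partial f x v = partial g x v.
Proof.
move=> fg; apply: eq_ext => I; rewrite !ffunE; apply: near_eq_derive.
by apply: filterS fg => z ->.
Qed.

End FormValuedMaps.

Section Forms.
Variables (R : realType) (X : cmanifold R).
Notation C := (Cplx R).
Implicit Types (eta zeta : form X) (V : set X).

(** Derivatives in a chart are taken along the inverse chart, so a condition on
    an open set of the manifold has to be transported to a neighbourhood of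
    the image point. *)
Lemma near_chart (i : chart X) x V : open V -> V x -> cdom i x ->
  \forall z \near cmap i x, V (@cinv R X i z) /\ cdom i (@cinv R X i z).
Proof.
move=> oV Vx ix.
have nx : nbhs (@cinv R X i (cmap i x)) (V `&` cdom i).
  rewrite cmapK //; apply: open_nbhs_nbhs; split => //.
  by apply: openI => //; exact: cdom_open.
exact: (cinv_cont ix nx).
Qed.

Definition local_form eta (i : chart X) (z : 'rV[C]_(cdim i)) : ext C (cdim i) :=
  eta i (cinv z).
Arguments local_form : clear implicits.

Lemma local_formE eta i x : cdom i x -> local_form eta i (cmap i x) = eta i x.
Proof. by move=> ix; rewrite /local_form cmapK. Qed.

Definition smooth_at eta i x := smooth (local_form eta i) (cmap i x).

Lemma dformE eta i x : dform eta i x = \sum_(l < cdim i)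
  dz C l * partial (local_form eta i) (cmap i x) (delta_mx 0 l).
Proof. by []. Qed.

Lemma eq_dform V eta zeta :
  open V -> eq_form V eta zeta -> eq_form V (dform eta) (dform zeta).
Proof.
move=> oV e i x Vx ix; rewrite !dformE; apply: eq_bigr => l _.
rewrite (eq_near_partial (g := local_form zeta i)) //.
by apply: filterS (near_chart oV Vx ix) => z [Vz iz]; exact: e.
Qed.

Lemma is_form_smooth q V eta i x :
  is_form q V eta -> V x -> cdom i x -> smooth_at eta i x.
Proof. by move=> [_ _ h] Vx ix I; exact: h. Qed.

Lemma is_form_homogeneous q V eta i x :
  is_form q V eta -> V x -> cdom i x -> homogeneous q (eta i x).
Proof. by move=> [h _ _]; exact: h. Qed.

Lemma is_formS q V V' eta : V' `<=` V -> is_form q V eta -> is_form q V' eta.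
Proof.
move=> V'V [h1 h2 h3]; split.
- by move=> i x /V'V; exact: h1.
- by move=> i j x /V'V; exact: h2.
- by move=> i I x /V'V; exact: h3.
Qed.

Lemma is_form_sum q V (T : Type) (r : seq T) (eta : T -> form X) :
  (forall t, is_form q V (eta t)) ->
  is_form q V (fun i x => \sum_(t <- r) eta t i x).
Proof.
move=> h; split.
- move=> i x Vx ix; apply: homogeneous_sum => t _.
  exact: is_form_homogeneous (h t) Vx ix.
- move=> i j x Vx ix jx; rewrite linear_sum; apply: eq_bigr => t _.
  by have [_ h2 _] := h t; exact: h2.
- move=> i I x Vx ix; move: I.
  apply: (@smooth_sum _ _ _ T r (fun t => local_form (eta t) i)) => t.
  exact: is_form_smooth (h t) Vx ix.
Qed.

Lemma is_formZ q V (k : C) eta :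
  is_form q V eta -> is_form q V (fun i x => k *: eta i x).
Proof.
move=> h; have [h1 h2 h3] := h; split.
- by move=> i x Vx ix; apply/homogeneousZ/h1.
- by move=> i j x Vx ix jx; rewrite linearZ /= -h2.
- move=> i I x Vx ix; move: I; apply: (@smoothZ _ _ _ k (local_form eta i)).
  exact: is_form_smooth h Vx ix.
Qed.

Lemma is_formD q V eta zeta : is_form q V eta -> is_form q V zeta ->
  is_form q V (fun i x => eta i x + zeta i x).
Proof.
move=> h k; have [h1 h2 _] := h; have [k1 k2 _] := k; split.
- by move=> i x Vx ix; apply: homogeneousD; [exact: h1|exact: k1].
- by move=> i j x Vx ix jx; rewrite linearD /= -h2 // -k2.
- move=> i I x Vx ix; move: I.
  apply: (@smoothD _ _ _ (local_form eta i) (local_form zeta i)).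
    exact: is_form_smooth h Vx ix.
  exact: is_form_smooth k Vx ix.
Qed.

Lemma is_form0 q V : is_form q V (@form0 R X).
Proof.
split.
- by move=> i x _ _; exact: homogeneous0.
- by move=> i j x _ _ _; rewrite linear0.
- by move=> i I x _ _; move: I; exact: (smooth_cst 0).
Qed.

Lemma is_formM p q V eta zeta : is_form p V eta -> is_form q V zeta ->
  is_form (p + q) V (fun i x => eta i x * zeta i x).
Proof.
move=> h k; have [h1 h2 h3] := h; have [k1 k2 k3] := k; split.
- by move=> i x Vx ix; apply: homogeneousM; [exact: h1|exact: k1].
- by move=> i j x Vx ix jx; rewrite pullbackM -h2 // -k2.
- move=> i I x Vx ix; move: I.
  apply: (@smoothM _ _ _ (local_form eta i) (local_form zeta i)).
    exact: is_form_smooth h Vx ix.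
  exact: is_form_smooth k Vx ix.
Qed.

Lemma dform0 i x : dform (@form0 R X) i x = 0.
Proof.
rewrite dformE big1 // => l _.
by rewrite [partial _ _ _](partial_cst 0) mulr0.
Qed.

Lemma dform_sum (T : Type) (r : seq T) (eta : T -> form X) i x :
  (forall t, smooth_at (eta t) i x) ->
  dform (fun i x => \sum_(t <- r) eta t i x) i x =
  \sum_(t <- r) dform (eta t) i x.
Proof.
move=> h; rewrite dformE.
rewrite [RHS](exchange_big _ _ _ _ _ (fun t l => _)) /=; apply: eq_bigr => l _.
rewrite -mulr_sumr -(@partial_sum _ _ _ T r (fun t => local_form (eta t) i)) //.
Qed.

Lemma dformZ (k : C) eta i x : smooth_at eta i x ->
  dform (fun i x => k *: eta i x) i x = k *: dform eta i x.
Proof.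
move=> h; rewrite !dformE scaler_sumr; apply: eq_bigr => l _.
by rewrite ext_scalerAr -(partialZ k _ h).
Qed.

Lemma dformD eta zeta i x : smooth_at eta i x -> smooth_at zeta i x ->
  dform (fun i x => eta i x + zeta i x) i x = dform eta i x + dform zeta i x.
Proof.
move=> h k; rewrite !dformE -big_split /=; apply: eq_bigr => l _.
by rewrite -mulrDr -(partialD _ h k).
Qed.

Lemma formB_ZD eta zeta :
  (fun i x => eta i x - zeta i x) = (fun i x => eta i x + (-1) *: zeta i x).
Proof.
apply: functional_extensionality_dep => i; apply/funext => x.
by rewrite scaleN1r.
Qed.

Lemma is_formB q V eta zeta : is_form q V eta -> is_form q V zeta ->
  is_form q V (fun i x => eta i x - zeta i x).
Proof. by move=> h k; rewrite formB_ZD; apply: is_formD => //; exact: is_formZ. Qed.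

Lemma dformB eta zeta i x : smooth_at eta i x -> smooth_at zeta i x ->
  dform (fun i x => eta i x - zeta i x) i x = dform eta i x - dform zeta i x.
Proof.
move=> h k; rewrite formB_ZD dformD //; last exact: (smoothZ (-1) k).
by rewrite dformZ // scaleN1r.
Qed.

(** The sign appears when the generator dz_l is moved past eta. *)
Lemma dformM p eta zeta i x : cdom i x -> homogeneous p (eta i x) ->
  smooth_at eta i x -> smooth_at zeta i x ->
  dform (fun i x => eta i x * zeta i x) i x =
  dform eta i x * zeta i x + (-1) ^+ p *: (eta i x * dform zeta i x).
Proof.
move=> ix hp se sz; rewrite !dformE mulr_suml mulr_sumr scaler_sumr -big_split /=.
apply: eq_bigr => l _; rewrite [partial _ _ _](partialM _ se sz) !local_formE //.
rewrite mulrDr !mulrA (homogeneous_mulC (homogeneous_dz C l) hp) mul1n.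
by rewrite -ext_scalerAl.
Qed.

End Forms.

(** * Covariant derivatives of matrix-valued forms *)

Section MatrixForms.
Variables (R : realType) (X : cmanifold R) (r : nat).
Notation C := (Cplx R).
Implicit Types (V : set X) (M N : mxform X r).

Definition is_mxform q V M : Prop :=
  forall k l, is_form q V (fun i x => M i x k l).

Definition dmx M : mxform X r := fun i x =>
  \matrix_(k, l) dform (fun i x => M i x k l) i x.

Lemma dmxE M i x k l : dmx M i x k l = dform (fun i x => M i x k l) i x.
Proof. exact: mxE. Qed.

Lemma is_mxformM p q V M N : is_mxform p V M -> is_mxform q V N ->
  is_mxform (p + q) V (fun i x => M i x * N i x).
Proof.
move=> hM hN k l; rewrite (_ : (fun i x => _) = fun (i : chart X) x =>
  \sum_j M i x k j * N i x j l).
  by apply: is_form_sum => j; exact: is_formM.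
by apply: functional_extensionality_dep => i; apply/funext => x; rewrite mxE.
Qed.

Lemma is_mxformS q V V' M : V' `<=` V -> is_mxform q V M -> is_mxform q V' M.
Proof. by move=> V'V hM k l; exact: is_formS (hM k l). Qed.

Lemma is_form_mxtr q V M : is_mxform q V M -> is_form q V (mxtr M).
Proof. by move=> hM; apply: is_form_sum => k; exact: hM. Qed.

Lemma is_mxform_homogeneous q V M i x :
  is_mxform q V M -> V x -> cdom i x -> homogeneous_mx q (M i x).
Proof. by move=> hM Vx ix k l; exact: is_form_homogeneous (hM k l) Vx ix. Qed.

Lemma dform_mxtr q V M i x : is_mxform q V M -> V x -> cdom i x ->
  dform (mxtr M) i x = \tr (dmx M i x).
Proof.
move=> hM Vx ix; rewrite dform_sum => [|k]; last exact: is_form_smooth (hM k k) Vx ix.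
by apply: eq_bigr => k _; rewrite mxE.
Qed.

Lemma dmxM p q V M N i x :
  is_mxform p V M -> is_mxform q V N -> V x -> cdom i x ->
  dmx (fun i x => M i x * N i x) i x =
  dmx M i x * N i x + (-1) ^+ p *: (M i x * dmx N i x).
Proof.
move=> hM hN Vx ix. apply/matrixP => k l. rewrite dmxE.
rewrite [RHS](mx_leibnizE p (M i x) (dmx M i x) (N i x) (dmx N i x) k l).
rewrite (_ : (fun i x => _) = fun (i : chart X) x =>
  \sum_j M i x k j * N i x j l); last first.
  by apply: functional_extensionality_dep => j; apply/funext => y; rewrite mxE.
rewrite dform_sum => [|j]; last first.
  exact: is_form_smooth (is_formM (hM k j) (hN j l)) Vx ix.
apply: eq_bigr => j _.
apply: etrans (f_equal2 (fun a b => a * N i x j l +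
  ((-1) ^+ p : C) *: (M i x k j * b)) (esym (dmxE M i x k j)) (esym (dmxE N i x j l))).
apply: (dformM ix (is_form_homogeneous (hM k j) Vx ix)).
  exact: is_form_smooth (hM k j) Vx ix.
exact: is_form_smooth (hN j l) Vx ix.
Qed.

Variables (V : set X) (i : chart X) (x : X).
Hypotheses (Vx : V x) (ix : cdom i x).
Variable W : 'M[ext C (cdim i)]_r.

(** M' is the covariant derivative of M at x, for the connection on
    endomorphism-valued forms induced by the connection matrix W. *)
Definition has_cov q M (M' : 'M[ext C (cdim i)]_r) : Prop :=
  is_mxform q V M /\ dmx M i x + W * M i x - (-1) ^+ q *: (M i x * W) = M'.

Lemma has_covM p q M N (M' N' : 'M[ext C (cdim i)]_r) :
  has_cov p M M' -> has_cov q N N' ->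
  has_cov (p + q) (fun i x => M i x * N i x)
    (M' * N i x + (-1) ^+ p *: (M i x * N')).
Proof.
move=> [hM eM] [hN eN]; split; first exact: is_mxformM.
rewrite (dmxM hM hN Vx ix) -eM -eN; exact: cov_leibniz.
Qed.

Lemma has_covM_odd p M N (M' N' : 'M[ext C (cdim i)]_r) : odd p ->
  has_cov p M M' -> has_cov 1 N N' ->
  has_cov p.+1 (fun i x => M i x * N i x) (M' * N i x - M i x * N').
Proof.
move=> p1 hM hN; have := has_covM hM hN.
by rewrite addn1 -(signr_odd _ p) p1 scaler_sign.
Qed.

Lemma has_covM_even p M N (M' N' : 'M[ext C (cdim i)]_r) : ~~ odd p ->
  has_cov p M M' -> has_cov 1 N N' ->
  has_cov p.+1 (fun i x => M i x * N i x) (M' * N i x + M i x * N').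
Proof.
move=> p0 hM hN; have := has_covM hM hN.
by rewrite addn1 -(signr_odd _ p) (negPf p0) scaler_sign.
Qed.

Lemma has_cov3 M1 M2 M3 (D1 D2 D3 : 'M[ext C (cdim i)]_r) :
  has_cov 1 M1 D1 -> has_cov 1 M2 D2 -> has_cov 1 M3 D3 ->
  has_cov 3 (fun i x => M1 i x * M2 i x * M3 i x)
    (der3 (M1 i x) D1 (M2 i x) D2 (M3 i x) D3).
Proof.
move=> h1 h2 h3; have h12 := has_covM_odd (p := 1) isT h1 h2.
exact: (has_covM_even (p := 2) isT h12 h3).
Qed.

Lemma has_cov4 M1 M2 M3 M4 (D1 D2 D3 D4 : 'M[ext C (cdim i)]_r) :
  has_cov 1 M1 D1 -> has_cov 1 M2 D2 -> has_cov 1 M3 D3 -> has_cov 1 M4 D4 ->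
  has_cov 4 (fun i x => M1 i x * M2 i x * M3 i x * M4 i x)
    (der4 (M1 i x) D1 (M2 i x) D2 (M3 i x) D3 (M4 i x) D4).
Proof.
by move=> h1 h2 h3 h4; exact: (has_covM_odd (p := 3) isT (has_cov3 h1 h2 h3) h4).
Qed.

Lemma has_cov5 M1 M2 M3 M4 M5 (D1 D2 D3 D4 D5 : 'M[ext C (cdim i)]_r) :
  has_cov 1 M1 D1 -> has_cov 1 M2 D2 -> has_cov 1 M3 D3 -> has_cov 1 M4 D4 ->
  has_cov 1 M5 D5 ->
  has_cov 5 (fun i x => M1 i x * M2 i x * M3 i x * M4 i x * M5 i x)
    (der5 (M1 i x) D1 (M2 i x) D2 (M3 i x) D3 (M4 i x) D4 (M5 i x) D5).
Proof.
by move=> h1 h2 h3 h4 h5; exact: (has_covM_even (p := 4) isT (has_cov4 h1 h2 h3 h4) h5).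
Qed.

Lemma has_cov_smooth q M (M' : 'M[ext C (cdim i)]_r) :
  has_cov q M M' -> smooth_at (mxtr M) i x.
Proof. by move=> [hM _]; exact: is_form_smooth (is_form_mxtr hM) Vx ix. Qed.

(** The terms with W form a graded commutator, on which the trace vanishes. *)
Lemma dform_mxtr_cov q M (M' : 'M[ext C (cdim i)]_r) :
  homogeneous_mx 1 W -> has_cov q M M' ->
  dform (mxtr M) i x = \tr M'.
Proof.
move=> hW [hM <-]; rewrite (dform_mxtr hM Vx ix) !raddfB raddfD /=.
have hMx := is_mxform_homogeneous hM Vx ix.
rewrite -!mulmxE (mxtrace_graded hW hMx) mul1n linearZ /=.
by rewrite addrK.
Qed.

End MatrixForms.

(** * Connection matrices *)

Section Connections.
Variables (R : realType) (X : cmanifold R) (A : Type) (U : A -> set X).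
Variables (E : vbundle U) (N : forall a, connection E (U a)).
Hypothesis oU : forall a, open (U a).
Notation C := (Cplx R).
Implicit Types (V W : set X) (s : sect E) (a b c d : A) (sigma tau : Eform E).

Lemma coordEE a (k : 'I_(rk E a)) sigma i x I :
  coordE k sigma i x I = coord (frame E a x) k (sigma i x I).
Proof. exact: ffunE. Qed.

Lemma eq_coordE a (k : 'I_(rk E a)) sigma tau i x :
  sigma i x = tau i x -> coordE k sigma i x = coordE k tau i x.
Proof. by move=> e; apply: eq_ext => I; rewrite !coordEE e. Qed.

Lemma coordEB a (k : 'I_(rk E a)) sigma tau :
  coordE k (fun i x => sigma i x - tau i x) =
  fun i x => coordE k sigma i x - coordE k tau i x.
Proof.
apply: functional_extensionality_dep => i; apply/funext => x; apply: eq_ext => I.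
by rewrite extD extN !coordEE !ffunE linearB.
Qed.

Lemma holomorphic_onS V V' (f : X -> C) :
  V' `<=` V -> holomorphic_on V f -> holomorphic_on V' f.
Proof. by move=> V'V h i x /V'V; exact: h. Qed.

Lemma frame_section V a j : V `<=` U a -> is_section V (@frame_sect _ _ _ _ E a j).
Proof.
move=> Va b k; apply: holomorphic_onS (frame_trans k j).
by move=> x [Vx Ub]; split=> //; exact: Va.
Qed.

Lemma is_sectionD V s t : is_section V s -> is_section V t ->
  is_section V (fun x => s x + t x).
Proof.
move=> hs ht a k i x Vx ix.
have -> : (fun x => coord (frame E a x) k (s x + t x)) =
    (fun x => coord (frame E a x) k (s x) + coord (frame E a x) k (t x)).
  by apply/funext => y; rewrite linearD.
exact: (differentiableD (hs a k i x Vx ix) (ht a k i x Vx ix)).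
Qed.

Lemma is_sectionZ V (f : X -> C) s : holomorphic_on V f -> is_section V s ->
  is_section V (fun x => f x *: s x).
Proof.
move=> hf hs a k i x Vx ix.
have -> : (fun x => coord (frame E a x) k (f x *: s x)) =
    (fun x => f x * coord (frame E a x) k (s x)).
  by apply/funext => y; rewrite linearZ.
by apply: (differentiableM (hf i x _ ix) (hs a k i x Vx ix)); case: Vx.
Qed.

Lemma is_section0 V : is_section V (fun x => 0 : fiber E x).
Proof.
move=> a k i x Vx ix.
have -> : (fun x => coord (frame E a x) k (0 : fiber E x)) = cst (0 : C).
  by apply/funext => y; rewrite linear0.
exact: differentiable_cst.
Qed.

Lemma is_section_sum V (T : Type) (r : seq T) (f : T -> X -> C) (s : T -> sect E) :
  (forall t, holomorphic_on V (f t)) -> (forall t, is_section V (s t)) ->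
  is_section V (fun x => \sum_(t <- r) f t x *: s t x).
Proof.
move=> hf hs; elim: r => [|t r IH].
  rewrite (_ : (fun x => _) = (fun x => 0 : fiber E x)); first exact: is_section0.
  by apply: functional_extensionality_dep => x; rewrite big_nil.
rewrite (_ : (fun x => _) =
  (fun x => f t x *: s t x + \sum_(t <- r) f t x *: s t x)).
  by apply: is_sectionD => //; exact: is_sectionZ.
by apply: functional_extensionality_dep => x; rewrite big_cons.
Qed.

Lemma nabla0 W (D : connection E W) V i x : open V -> V `<=` W -> V x -> cdom i x ->
  D V (fun x => 0 : fiber E x) i x = 0.
Proof.
move=> oV VW Vx ix; have s0 := is_section0 (V := V).
have := nablaD D oV VW s0 s0 Vx ix.
rewrite (_ : (fun x => _ + _) = (fun x => 0 : fiber E x)); last first.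
  by apply: functional_extensionality_dep => y; rewrite addr0.
by move=> e; apply: (addrI (D V (fun x => 0 : fiber E x) i x)); rewrite addr0.
Qed.

Lemma nabla_sum W (D : connection E W) V (T : Type) (r : seq T)
    (f : T -> X -> C) (s : T -> sect E) i x :
  open V -> V `<=` W -> V x -> cdom i x ->
  (forall t, holomorphic_on V (f t)) -> (forall t, is_section V (s t)) ->
  D V (fun x => \sum_(t <- r) f t x *: s t x) i x =
  \sum_(t <- r)
    (tensE (s t) (dform (fun_form (f t))) i x + f t x *: D V (s t) i x).
Proof.
move=> oV VW Vx ix hf hs; elim: r => [|t r IH].
  rewrite big_nil (_ : (fun x => _) = (fun x => 0 : fiber E x)).
    exact: nabla0.
  by apply: functional_extensionality_dep => y; rewrite big_nil.
rewrite big_cons (_ : (fun x => _) =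
  (fun x => f t x *: s t x + \sum_(t <- r) f t x *: s t x)).
  rewrite (nablaD D oV VW (is_sectionZ (hf t) (hs t)) (is_section_sum r hf hs) Vx ix).
  by rewrite (nabla_leibniz D oV VW (hf t) (hs t) Vx ix) IH.
by apply: functional_extensionality_dep => y; rewrite big_cons.
Qed.

(** The matrix of nabla_c in the frame over U_a, meaningful on the intersection
    of U_a and U_c. *)
Definition conn_mx a c : mxform X (rk E a) := fun i x =>
  \matrix_(k, j) coordE k (N c (U a `&` U c) (frame_sect j)) i x.

(** Connections are morphisms of sheaves: the matrix can be computed on any
    smaller open set. *)
Lemma conn_mxE a c V i x k j :
  open V -> V `<=` U a `&` U c -> V x -> cdom i x ->
  coordE k (N c V (frame_sect j)) i x = conn_mx a c i x k j.
Proof.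
move=> oV Vac Vx ix; rewrite mxE; apply: eq_coordE; apply: esym.
apply: (nabla_restr (N c) _ oV Vac _ _ _ _ Vx ix) => //.
- by apply: openI; exact: oU.
- by apply: frame_section => y [].
- by apply: frame_section => y /Vac[].
Qed.

Lemma is_form_conn a c V (k j : 'I_(rk E a)) : open V -> V `<=` U a `&` U c ->
  is_form 1 V (coordE k (N c V (frame_sect j))).
Proof.
move=> oV Vac; have Va : V `<=` U a by move=> y /Vac[].
have Vc : V `<=` U c by move=> y /Vac[].
have := nabla_form (N c) oV Vc (frame_section j Va) k; apply: is_formS.
by move=> y Vy; split=> //; exact: Va.
Qed.

Lemma is_mxform_conn a c : is_mxform 1 (U a `&` U c) (conn_mx a c).
Proof.
move=> k j; rewrite (_ : (fun i x => _) =
  coordE k (N c (U a `&` U c) (frame_sect j))).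
  by apply: is_form_conn => //; apply: openI; exact: oU.
by apply: functional_extensionality_dep => i; apply/funext => x; rewrite mxE.
Qed.

Lemma omega_inE a b c i x : U a x -> U b x -> U c x -> cdom i x ->
  omega_in N a b c i x = conn_mx a c i x - conn_mx a b i x.
Proof.
move=> Ua Ub Uc ix; set V := U a `&` U b `&` U c.
have oV : open V by do 2?apply: openI; exact: oU.
have Vx : V x by [].
apply/matrixP => k j; rewrite [LHS]mxE [RHS]mxE [X in _ = _ + X]mxE.
rewrite coordEB (conn_mxE _ _ oV _ Vx ix); last by move=> y [[]].
by rewrite (conn_mxE _ _ oV _ Vx ix) // => y [[]].
Qed.

Lemma is_mxform_omega a b c :
  is_mxform 1 (U a `&` U b `&` U c) (omega_in N a b c).
Proof.
set V := U a `&` U b `&` U c.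
have oV : open V by do 2?apply: openI; exact: oU.
move=> k j; rewrite (_ : (fun i x => _) = fun i x =>
  coordE k (N c V (frame_sect j)) i x - coordE k (N b V (frame_sect j)) i x).
  by apply: is_formB; apply: is_form_conn => // y [[]].
rewrite -coordEB.
by apply: functional_extensionality_dep => i; apply/funext => x; rewrite mxE.
Qed.

End Connections.

Section FlatConnections.
Variables (R : realType) (X : cmanifold R) (A : Type) (U : A -> set X).
Variables (E : vbundle U) (N : forall a, connection E (U a)).
Hypothesis oU : forall a, open (U a).
Notation C := (Cplx R).
Implicit Types (V W : set X) (s : sect E) (a b c d : A) (sigma tau : Eform E).

Lemma coord_frame a (k l : 'I_(rk E a)) x : U a x ->
  coord (frame E a x) k (frame_sect l x) = (l == k)%:R.
Proof.
move=> Ux; rewrite /frame_sect (tnth_nth 0) coord_free //.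
by have /andP[] := frameP E Ux.
Qed.

Lemma frame_decomposition a x (v : fiber E x) : U a x ->
  v = \sum_k coord (frame E a x) k v *: frame_sect k x.
Proof.
move=> Ux; rewrite {1}(coord_basis (frameP E Ux) (memvf v)).
by apply: eq_bigr => k _; rewrite /frame_sect (tnth_nth 0).
Qed.

Lemma coord_lin a (k : 'I_(rk E a)) x r (f : 'I_r -> C) (v : 'I_r -> fiber E x) :
  coord (frame E a x) k (\sum_j f j *: v j) =
  \sum_j f j * coord (frame E a x) k (v j).
Proof. by rewrite linear_sum; apply: eq_bigr => j _; exact: linearZ. Qed.

Lemma coordB a (k : 'I_(rk E a)) x (v w : fiber E x) :
  coord (frame E a x) k (v - w) =
  coord (frame E a x) k v - coord (frame E a x) k w.
Proof. exact: linearB. Qed.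

Lemma coordE_wedge a (k : 'I_(rk E a)) sigma (eta : form X) i x :
  coordE k (wedgeE sigma eta) i x = coordE k sigma i x * eta i x.
Proof.
apply: eq_ext => S; rewrite coordEE extM ffunE linear_sum; apply: eq_bigr => I _.
rewrite linear_sum; apply: eq_bigr => J _.
by rewrite linearZ /= coordEE mulrAC.
Qed.

Lemma coordE_tens a (k : 'I_(rk E a)) s (eta : form X) i x :
  coordE k (tensE s eta) i x = coord (frame E a x) k (s x) *: eta i x.
Proof. by apply: eq_ext => S; rewrite coordEE extZ ffunE linearZ /= mulrC. Qed.

Lemma coordE_sum a (k : 'I_(rk E a)) (T : Type) (r : seq T) (sigma : T -> Eform E) i x :
  coordE k (fun i x => \sum_(t <- r) sigma t i x) i x =
  \sum_(t <- r) coordE k (sigma t) i x.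
Proof.
apply: eq_ext => S; rewrite ext_sum coordEE.
elim: r => [|t r IH]; first by rewrite !big_nil ffunE linear0.
by rewrite !big_cons ffunE linearD /= IH coordEE.
Qed.

Lemma coordED a (k : 'I_(rk E a)) sigma tau i x :
  coordE k (fun i x => sigma i x + tau i x) i x = coordE k sigma i x + coordE k tau i x.
Proof. by apply: eq_ext => S; rewrite extD !coordEE ffunE linearD. Qed.

(** The curvature of nabla_c applied to the frame over U_a: decomposing
    nabla_c e_j along the frame, its k-th coordinate is the (k, j) entry of
    Om^2 + d Om. *)
Lemma flat_conn a c i x : flat (N c) -> U a x -> U c x -> cdom i x ->
  dmx (conn_mx N a c) i x = - (conn_mx N a c i x * conn_mx N a c i x).
Proof.
move=> Nflat Ua Uc ix; set V := U a `&` U c.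
have oV : open V by apply: openI; exact: oU.
have Va : V `<=` U a by move=> y [].
have Vc : V `<=` U c by move=> y [].
apply/matrixP => k j.
pose eta (l : 'I_(rk E a)) : form X := coordE l (N c V (frame_sect j)).
have := Nflat V (frame_sect j) oV Vc (frame_section j Va) V (rk E a)
  (fun l => frame_sect l) eta oV (@subset_refl _ V)
  (fun l => frame_section l Va) (fun l => is_form_conn N l j oV (@subset_refl _ V)).
have dec : eq_Eform V (N c V (frame_sect j))
    (fun i x => \sum_l tensE (frame_sect l) (eta l) i x).
  move=> i' y Vy iy; apply/ffunP => S.
  rewrite sum_ffunE [LHS](frame_decomposition _ (Va _ Vy)).
  by apply: eq_bigr => l _; rewrite ffunE coordEE.
move=> /(_ dec i x (conj Ua Uc) ix) e0.
have : 0 = coordE k (fun i x => \sum_l (wedgeE (N c V (frame_sect l)) (eta l) i x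
    + tensE (frame_sect l) (dform (eta l)) i x)) i x.
  rewrite -(eq_coordE k (sigma := fun i x => 0) e0).
  by apply: eq_ext => S; rewrite coordEE ext0 ffunE linear0.
rewrite coordE_sum => e.
have {e} : 0 = (conn_mx N a c i x * conn_mx N a c i x) k j + dform (eta k) i x.
  rewrite [LHS]e.
  rewrite (eq_bigr (fun l => coordE k (N c V (frame_sect l)) i x * eta l i x
     + (l == k)%:R *: dform (eta l) i x)) => [|l _]; last first.
    by rewrite coordED coordE_wedge coordE_tens coord_frame.
  rewrite big_split /=; congr (_ + _).
    rewrite mxE; apply: eq_bigr => l _.
    by rewrite -(conn_mxE N oU k l oV (@subset_refl _ V) (conj Ua Uc) ix)
      -(conn_mxE N oU l j oV (@subset_refl _ V) (conj Ua Uc) ix).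
  rewrite (bigD1 k) //= eqxx scale1r big1 ?addr0 // => l lk.
  by rewrite (negPf lk) scale0r.
move=> e; rewrite dmxE [RHS]mxE.
rewrite (_ : (fun i x => _) = eta k); last first.
  by apply: functional_extensionality_dep => i'; apply/funext => y; rewrite mxE.
by apply/eqP; rewrite -addr_eq0 addrC -e.
Qed.

Definition trans_mx a b x : 'M[C]_(rk E a, rk E b) :=
  \matrix_(k, l) coord (frame E a x) k (frame_sect l x).

Lemma trans_mxK a b x : U a x -> U b x ->
  trans_mx a b x *m trans_mx b a x = 1%:M.
Proof.
move=> Ua Ub; apply/matrixP => k l; rewrite !mxE eq_sym -(coord_frame k l Ua).
rewrite [in RHS](frame_decomposition (frame_sect l x) Ub) coord_lin.
by apply: eq_bigr => j _; rewrite !mxE mulrC.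
Qed.

(** The derivative of the transition matrix contributes the same term to both
    connection matrices, so their difference transforms by conjugation. *)
Lemma conn_change_frame a b c d i x :
  U a x -> U b x -> U c x -> U d x -> cdom i x ->
  conn_mx N b d i x - conn_mx N b c i x =
  conj_mx (trans_mx b a x) (trans_mx a b x)
    (conn_mx N a d i x - conn_mx N a c i x).
Proof.
move=> Ua Ub Uc Ud ix; set V := U a `&` U b `&` U c `&` U d.
have oV : open V by do 3?apply: openI; exact: oU.
have Vx : V x by [].
have [Va Vb Vc Vd] : [/\ V `<=` U a, V `<=` U b, V `<=` U c & V `<=` U d].
  by split=> y [[[]]].
have Vad : V `<=` U a `&` U d by move=> y Vy; split; [exact: Va|exact: Vd].
have Vac : V `<=` U a `&` U c by move=> y Vy; split; [exact: Va|exact: Vc].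
have Vbd : V `<=` U b `&` U d by move=> y Vy; split; [exact: Vb|exact: Vd].
have Vbc : V `<=` U b `&` U c by move=> y Vy; split; [exact: Vb|exact: Vc].
apply/matrixP => m l; rewrite conj_mxE.
pose g k y : C := coord (frame E a y) k (frame_sect l y).
have hg k : holomorphic_on V (g k).
  by apply: holomorphic_onS (frame_trans k l) => y Vy; split; [exact: Va|exact: Vb].
have he k : is_section V (@frame_sect _ _ _ _ E a k) by exact: frame_section.
have nab e : V `<=` U e -> N e V (frame_sect l) i x =
    \sum_k (tensE (frame_sect k) (dform (fun_form (g k))) i x
            + g k x *: N e V (frame_sect k) i x).
  move=> Ve; rewrite -(nabla_sum (N e) _ oV Ve Vx ix hg he).
  apply: (nabla_restr (N e) oV oV _ Ve _ _ _ Vx ix) => //.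
  - exact: frame_section.
  - exact: is_section_sum.
  - by move=> y Vy; exact: frame_decomposition (Va _ Vy).
pose v (k : 'I_(rk E a)) := N d V (frame_sect k) i x - N c V (frame_sect k) i x.
have nabB : N d V (frame_sect l) i x - N c V (frame_sect l) i x = \sum_k g k x *: v k.
  rewrite !nab // -sumrB; apply: eq_bigr => k _.
  by rewrite opprD addrACA subrr add0r -scalerBr.
rewrite [LHS]mxE [X in _ + X]mxE -(conn_mxE N oU m l oV Vbd Vx ix).
rewrite -(conn_mxE N oU m l oV Vbc Vx ix).
apply: eq_ext => S; rewrite extD extN !coordEE -coordB.
have -> : N d V (frame_sect l) i x S - N c V (frame_sect l) i x S =
    \sum_k g k x *: v k S.
  have := congr1 (fun w : {ffun {set 'I_(cdim i)} -> fiber E x} => w S) nabB.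
  by rewrite sum_ffunE !ffunE => ->; apply: eq_bigr => k _; rewrite ffunE.
rewrite coord_lin ext_sum; apply: eq_bigr => k _; rewrite ext_sum.
rewrite [v k S](frame_decomposition _ Ua) coord_lin mulr_sumr.
apply: eq_bigr => n _; rewrite extZ.
have <- : coord (frame E a x) n (v k S) =
    (conn_mx N a d i x - conn_mx N a c i x) n k S.
  rewrite mxE extD [(- conn_mx N a c i x) n k]mxE extN.
  rewrite -(conn_mxE N oU n k oV Vad Vx ix).
  by rewrite -(conn_mxE N oU n k oV Vac Vx ix) !coordEE /v !ffunE coordB.
rewrite [trans_mx b a x m n]mxE [trans_mx a b x k l]mxE /g.
by rewrite mulrCA [RHS]mulrC; congr (_ * _); exact: mulrC.
Qed.

End FlatConnections.

Section ConnectionForms.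
Variables (R : realType) (X : cmanifold R) (A : Type) (U : A -> set X).
Variables (E : vbundle U) (N : forall a, connection E (U a)).
Hypothesis oU : forall a, open (U a).
Hypothesis Nflat : forall a, flat (N a).
Notation C := (Cplx R).
Implicit Types (V : set X) (a b c d : A).

(** In D omega_bc the matrix of nabla_a only serves to turn the matrices of
    nabla_b and nabla_c into differences. *)
Lemma cov_omega a b c V i x :
  open V -> V `<=` U a `&` U b `&` U c -> V x -> cdom i x ->
  has_cov V x (conn_mx N a a i x) 1 (omega_in N a b c)
    (omega_in N a a b i x * omega_in N a a b i x
     - omega_in N a a c i x * omega_in N a a c i x).
Proof.
move=> oV Vabc Vx ix; have [[Ua Ub] Uc] := Vabc x Vx; split.
  by apply: (is_mxformS Vabc); exact: is_mxform_omega.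
have -> : dmx (omega_in N a b c) i x =
    dmx (conn_mx N a c) i x - dmx (conn_mx N a b) i x.
  apply/matrixP => k l; rewrite dmxE [RHS]mxE dmxE.
  rewrite [(- dmx (conn_mx N a b) i x) k l]mxE dmxE.
  rewrite -dformB; last 2 first.
  - exact: is_form_smooth (is_mxform_conn N oU c k l) (conj Ua Uc) ix.
  - exact: is_form_smooth (is_mxform_conn N oU b k l) (conj Ua Ub) ix.
  apply: (eq_dform oV) Vx ix => i' y /Vabc[[Ua' Ub'] Uc'] iy.
  by rewrite omega_inE // !mxE.
rewrite (flat_conn oU (@Nflat c) Ua Uc ix) (flat_conn oU (@Nflat b) Ua Ub ix).
rewrite (omega_inE N oU Ua Ub Uc ix) (omega_inE N oU Ua Ua Ub ix).
rewrite (omega_inE N oU Ua Ua Uc ix).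
exact: cov_difference.
Qed.

Lemma omega_add a b c d i x : U a x -> U b x -> U c x -> U d x -> cdom i x ->
  omega_in N a b d i x = omega_in N a b c i x + omega_in N a c d i x.
Proof.
move=> Ua Ub Uc Ud ix.
rewrite (omega_inE N oU Ua Ub Ud ix) (omega_inE N oU Ua Ub Uc ix).
by rewrite (omega_inE N oU Ua Uc Ud ix) [RHS]addrC addrA subrK.
Qed.

(** In the conclusion the left-hand side is written in the frame over U_b and
    the right-hand side in the frame over U_a. *)
Lemma omega_conj a b c d i x : U a x -> U b x -> U c x -> U d x -> cdom i x ->
  omega_in N b c d i x =
  conj_mx (trans_mx E b a x) (trans_mx E a b x) (omega_in N a c d i x).
Proof.
move=> Ua Ub Uc Ud ix.
rewrite (omega_inE N oU Ub Uc Ud ix) (omega_inE N oU Ua Uc Ud ix).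
exact: conn_change_frame.
Qed.

Section Point.
Variables (a b c d : A) (V : set X) (i : chart X) (x : X).
Hypotheses (oV : open V) (Vx : V x) (ix : cdom i x).
Hypotheses (Va : V `<=` U a) (Vb : V `<=` U b).
Notation om := (omega_in N a).
Notation W := (conn_mx N a a i x).

(** This is [cov_omega] with nabla_a as first connection, since omega_aa = 0. *)
Lemma cov_omega_first : has_cov V x W 1 (om a b) (- (om a b i x * om a b i x)).
Proof.
have Vab : V `<=` U a `&` U a `&` U b.
  by move=> y Vy; split; [split; exact: Va|exact: Vb].
have := cov_omega oV Vab Vx ix.
have -> : om a a i x = 0.
  by rewrite (omega_inE N oU (Va Vx) (Va Vx) (Va Vx) ix) subrr.
by rewrite mulr0 sub0r.
Qed.

Lemma cov_omega_next e f : V `<=` U e -> V `<=` U f ->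
  let P := om a e i x in let Z := om e f i x in
  has_cov V x W 1 (om e f) (- (P * Z + Z * P + Z * Z)).
Proof.
move=> Ve Vf P Z; have Vef : V `<=` U a `&` U e `&` U f.
  by move=> y Vy; split; [split; [exact: Va|exact: Ve]|exact: Vf].
have [hM covE] := cov_omega oV Vef Vx ix; split; first exact: hM.
apply: (etrans covE); rewrite (omega_add (Va Vx) (Va Vx) (Ve _ Vx) (Vf _ Vx) ix).
exact: cov_square_addB.
Qed.

End Point.

End ConnectionForms.

(** * Cech faces *)

Section AlternatingSums.
Variables (K : comNzRingType) (n : nat).

Lemma alt_sum3 (t : 'I_3 -> ext K n) :
  \sum_(j < 3) (-1) ^+ j *: t j = t 0 - t 1 + t 2.
Proof.
rewrite !big_ord_recl big_ord0 addr0 expr0 scale1r expr1 scaleN1r sqrrN expr1n scale1r.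
by rewrite addrA; congr (t _ - t _ + t _); apply: val_inj.
Qed.

Lemma alt_sum4 (t : 'I_4 -> ext K n) :
  \sum_(j < 4) (-1) ^+ j *: t j = t 0 - t 1 + t 2 - t 3.
Proof.
rewrite !big_ord_recl big_ord0 addr0 expr0 scale1r expr1 scaleN1r sqrrN expr1n scale1r.
rewrite -[X in (-1) ^+ X]/3%N -signr_odd expr1 scaleN1r.
by rewrite !addrA; congr (t _ - t _ + t _ - t _); apply: val_inj.
Qed.

Lemma alt_sum5 (t : 'I_5 -> ext K n) :
  \sum_(j < 5) (-1) ^+ j *: t j = t 0 - t 1 + t 2 - t 3 + t 4.
Proof.
rewrite !big_ord_recl big_ord0 addr0 expr0 scale1r expr1 scaleN1r sqrrN expr1n scale1r.
rewrite -[X in (-1) ^+ X *: t _ + (_ *: _)]/3%N -signr_odd expr1 scaleN1r.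
rewrite -[X in (-1) ^+ X]/4%N -signr_odd expr0 scale1r.
by rewrite !addrA; congr (t _ - t _ + t _ - t _ + t _); apply: val_inj.
Qed.

Lemma signr2_scale (t : ext K n) : (-1) ^+ 2 *: t = t.
Proof. by rewrite sqrrN expr1n scale1r. Qed.

Lemma signr3_scale (t : ext K n) : (-1) ^+ 3 *: t = - t.
Proof. by rewrite -signr_odd scaleN1r. Qed.

End AlternatingSums.

Section CechFaces.
Variables (R : realType) (X : cmanifold R) (A : Type).

Lemma face_eq p (a : 'I_p.+2 -> A) (j : 'I_p.+2) (k : 'I_p.+1) (l : 'I_p.+2) :
  bump j k = l -> (a \o lift j) k = a l.
Proof. by move=> e; congr a; exact: val_inj. Qed.

Lemma cech_form0 p (a : 'I_p.+2 -> A) i x :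
  cech_d (fun _ : 'I_p.+1 -> A => @form0 R X) a i x = 0.
Proof. by rewrite /cech_d big1 // => j _; exact: scaler0. Qed.

Lemma cech_d1 (F : A -> A -> form X) (a : 'I_3 -> A) i x :
  cech_d (fun a : 'I_2 -> A => F (a 0) (a 1)) a i x =
  F (a 1) (a 2) i x - F (a 0) (a 2) i x + F (a 0) (a 1) i x.
Proof.
rewrite /cech_d (alt_sum3 (fun j => F ((a \o lift j) 0) ((a \o lift j) 1) i x)).
by rewrite !(@face_eq _ a 0 0 1, @face_eq _ a 0 1 2, @face_eq _ a 1 0 0,
  @face_eq _ a 1 1 2, @face_eq _ a 2 0 0, @face_eq _ a 2 1 1).
Qed.

Lemma cech_d2 (F : A -> A -> A -> form X) (a : 'I_4 -> A) i x :
  cech_d (fun a : 'I_3 -> A => F (a 0) (a 1) (a 2)) a i x =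
  F (a 1) (a 2) (a 3) i x - F (a 0) (a 2) (a 3) i x
  + F (a 0) (a 1) (a 3) i x - F (a 0) (a 1) (a 2) i x.
Proof.
rewrite /cech_d (alt_sum4 (fun j =>
  F ((a \o lift j) 0) ((a \o lift j) 1) ((a \o lift j) 2) i x)).
by rewrite !(@face_eq _ a 0 0 1, @face_eq _ a 0 1 2, @face_eq _ a 0 2 3,
  @face_eq _ a 1 0 0, @face_eq _ a 1 1 2, @face_eq _ a 1 2 3,
  @face_eq _ a 2 0 0, @face_eq _ a 2 1 1, @face_eq _ a 2 2 3,
  @face_eq _ a 3 0 0, @face_eq _ a 3 1 1, @face_eq _ a 3 2 2).
Qed.

Lemma cech_d3 (F : A -> A -> A -> A -> form X) (a : 'I_5 -> A) i x :
  cech_d (fun a : 'I_4 -> A => F (a 0) (a 1) (a 2) (a 3)) a i x =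
  F (a 1) (a 2) (a 3) (a 4) i x - F (a 0) (a 2) (a 3) (a 4) i x
  + F (a 0) (a 1) (a 3) (a 4) i x - F (a 0) (a 1) (a 2) (a 4) i x
  + F (a 0) (a 1) (a 2) (a 3) i x.
Proof.
rewrite /cech_d (alt_sum5 (fun j =>
  F ((a \o lift j) 0) ((a \o lift j) 1) ((a \o lift j) 2) ((a \o lift j) 3) i x)).
by rewrite !(@face_eq _ a 0 0 1, @face_eq _ a 0 1 2, @face_eq _ a 0 2 3,
  @face_eq _ a 0 3 4, @face_eq _ a 1 0 0, @face_eq _ a 1 1 2, @face_eq _ a 1 2 3,
  @face_eq _ a 1 3 4, @face_eq _ a 2 0 0, @face_eq _ a 2 1 1, @face_eq _ a 2 2 3,
  @face_eq _ a 2 3 4, @face_eq _ a 3 0 0, @face_eq _ a 3 1 1, @face_eq _ a 3 2 2,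
  @face_eq _ a 3 3 4, @face_eq _ a 4 0 0, @face_eq _ a 4 1 1, @face_eq _ a 4 2 2,
  @face_eq _ a 4 3 3).
Qed.

End CechFaces.

(** * The total cocycle *)

Section Differentials.
Variables (R : realType) (X : cmanifold R) (A : Type) (U : A -> set X).
Variables (E : vbundle U) (N : forall a, connection E (U a)).
Hypothesis oU : forall a, open (U a).
Notation C := (Cplx R).
Implicit Types (V : set X) (a b c d e : A).
Notation om := (omega_in N).

Definition pow5_form a b : form X := fun i x => pow5_mx (om a a b i x).

Definition rho_form a b c : form X := fun i x =>
  rho_mx (om a a b i x) (om a b c i x).

Definition tr3_form a b c d : form X := fun i x =>
  \tr (om a a b i x * om a b c i x * om a c d i x).

Lemma at3_tot1 : at3_tot N 1 = fun J => pow5_form (J 0) (J 1).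
Proof. by []. Qed.

Lemma at3_tot2 : at3_tot N 2 = fun J => rho_form (J 0) (J 1) (J 2).
Proof. by []. Qed.

Lemma at3_tot3 : at3_tot N 3 = fun J => tr3_form (J 0) (J 1) (J 2) (J 3).
Proof. by []. Qed.

Lemma is_mxform_om V a b c : V `<=` U a -> V `<=` U b -> V `<=` U c ->
  is_mxform 1 V (om a b c).
Proof.
move=> Va Vb Vc; apply: is_mxformS (is_mxform_omega N oU b c).
by move=> y Vy; split; [split; [exact: Va|exact: Vb]|exact: Vc].
Qed.

Lemma is_form_pow5 V a b : V `<=` U a -> V `<=` U b ->
  is_form 5 V (pow5_form a b).
Proof.
move=> Va Vb; have h := is_mxform_om Va Va Vb.
apply: is_formZ; apply: is_form_mxtr.
exact: (is_mxformM (is_mxformM (is_mxformM (is_mxformM h h) h) h) h).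
Qed.

Lemma is_form_rho V a b c : V `<=` U a -> V `<=` U b -> V `<=` U c ->
  is_form 4 V (rho_form a b c).
Proof.
move=> Va Vb Vc; have hA := is_mxform_om Va Va Vb; have hZ := is_mxform_om Va Vb Vc.
have h4 M1 M2 M3 M4 (k : C) : is_mxform 1 V M1 -> is_mxform 1 V M2 ->
    is_mxform 1 V M3 -> is_mxform 1 V M4 ->
    is_form 4 V (fun i x => k *: mxtr (fun i x => M1 i x * M2 i x * M3 i x * M4 i x :
      'M[ext C (cdim i)]_(rk E a)) i x).
  move=> h1 h2 h3 h4; apply: is_formZ; apply: is_form_mxtr.
  exact: (is_mxformM (is_mxformM (is_mxformM h1 h2) h3) h4).
apply: (is_formB (is_formB (is_formD _ _) _) _); exact: h4.
Qed.

Lemma is_form_tr3 V a b c d :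
  V `<=` U a -> V `<=` U b -> V `<=` U c -> V `<=` U d ->
  is_form 3 V (tr3_form a b c d).
Proof.
move=> Va Vb Vc Vd; apply: is_form_mxtr.
exact: (is_mxformM (is_mxformM (is_mxform_om Va Va Vb) (is_mxform_om Va Vb Vc))
  (is_mxform_om Va Vc Vd)).
Qed.

Hypothesis Nflat : forall a, flat (N a).

Section AtPoint.
Variables (V : set X) (i : chart X) (x : X).
Hypotheses (oV : open V) (Vx : V x) (ix : cdom i x).

Lemma homogeneous_om a b c : V `<=` U a -> V `<=` U b -> V `<=` U c ->
  homogeneous_mx 1 (om a b c i x).
Proof.
move=> Va Vb Vc.
exact: is_mxform_homogeneous (is_mxform_om Va Vb Vc) Vx ix.
Qed.

Lemma homogeneous_conn a : V `<=` U a -> homogeneous_mx 1 (conn_mx N a a i x).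
Proof.
move=> Va; apply: (is_mxform_homogeneous (is_mxform_conn N oU (a := a) a) _ ix).
by split; exact: Va.
Qed.

Lemma dform_pow5 a b : V `<=` U a -> V `<=` U b -> dform (pow5_form a b) i x = 0.
Proof.
move=> Va Vb; have h := cov_omega_first oU Nflat oV Vx ix Va Vb.
have h5 := has_cov5 Vx ix h h h h h.
rewrite (dformZ (- 10^-1) (has_cov_smooth Vx ix h5)).
rewrite (dform_mxtr_cov Vx ix (homogeneous_conn Va) h5).
rewrite (tr_der5 (homogeneous_om Va Va Vb)).
exact: scaler0.
Qed.

Lemma dform_rho a b c : V `<=` U a -> V `<=` U b -> V `<=` U c ->
  let P := om a a b i x in let Z := om a b c i x in
  dform (rho_form a b c) i x =
  drho_mx P (- (P * P)) Z (- (P * Z + Z * P + Z * Z)).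
Proof.
move=> Va Vb Vc P Z; have hP := cov_omega_first oU Nflat oV Vx ix Va Vb.
have hZ := cov_omega_next oU Nflat oV Vx ix Va Vb Vc.
have h1 := has_cov4 Vx ix hP hZ hP hZ; have h2 := has_cov4 Vx ix hP hP hZ hZ.
have h3 := has_cov4 Vx ix hP hP hP hZ; have h4 := has_cov4 Vx ix hP hZ hZ hZ.
have s1 := has_cov_smooth Vx ix h1; have s2 := has_cov_smooth Vx ix h2.
have s3 := has_cov_smooth Vx ix h3; have s4 := has_cov_smooth Vx ix h4.
have hW := homogeneous_conn Va.
pose z k eta : form X := fun i x => (k : C) *: (eta : form X) i x.
have zs k eta : smooth_at eta i x -> smooth_at (z k eta) i x.
  by move=> s; exact: (smoothZ k s).
set t1 := mxtr _ in s1; set t2 := mxtr _ in s2; set t3 := mxtr _ in s3.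
set t4 := mxtr _ in s4.
have s12 : smooth_at (fun i x => z (- 4^-1) t1 i x + z 2^-1 t2 i x) i x.
  exact: (smoothD (zs _ _ s1) (zs _ _ s2)).
have s123 : smooth_at (fun i x => z (- 4^-1) t1 i x + z 2^-1 t2 i x - z 2^-1 t3 i x) i x.
  rewrite formB_ZD; exact: (smoothD s12 (smoothZ (-1) (zs _ _ s3))).
have dz4 k M (D : 'M[ext C (cdim i)]_(rk E a)) :
    has_cov V x (conn_mx N a a i x) 4 M D -> dform (z k (mxtr M)) i x = k *: \tr D.
  move=> hM; apply: etrans (dformZ k (has_cov_smooth Vx ix hM)) _.
  by rewrite (dform_mxtr_cov Vx ix hW hM).
have combE (u1 u2 u3 u4 v1 v2 v3 v4 : ext C (cdim i)) :
    u1 = v1 -> u2 = v2 -> u3 = v3 -> u4 = v4 ->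
    u1 + u2 - u3 - u4 = v1 + v2 - v3 - v4.
  by move=> -> -> -> ->.
rewrite [LHS](dformB s123 (zs _ _ s4)) (dformB s12 (zs _ _ s3)).
rewrite (dformD (zs _ _ s1) (zs _ _ s2)).
exact: (combE _ _ _ _ _ _ _ _ (dz4 _ _ _ h1) (dz4 _ _ _ h2) (dz4 _ _ _ h3)
  (dz4 _ _ _ h4)).
Qed.

Lemma dform_tr3 a b c d : V `<=` U a -> V `<=` U b -> V `<=` U c -> V `<=` U d ->
  let P := om a a b i x in let Z := om a b c i x in let Y := om a c d i x in
  dform (tr3_form a b c d) i x =
  \tr (der3 P (- (P * P)) Z (- (P * Z + Z * P + Z * Z))
    Y (- ((P + Z) * Y + Y * (P + Z) + Y * Y))).
Proof.
move=> Va Vb Vc Vd P Z Y; have hP := cov_omega_first oU Nflat oV Vx ix Va Vb.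
have hZ := cov_omega_next oU Nflat oV Vx ix Va Vb Vc.
have hY := cov_omega_next oU Nflat oV Vx ix Va Vc Vd.
rewrite [LHS](dform_mxtr_cov Vx ix (homogeneous_conn Va) (has_cov3 Vx ix hP hZ hY)).
by rewrite (omega_add N oU (Va _ Vx) (Va _ Vx) (Vb _ Vx) (Vc _ Vx) ix).
Qed.

End AtPoint.

End Differentials.

Section Closedness.
Variables (R : realType) (X : cmanifold R) (A : Type) (U : A -> set X).
Variables (E : vbundle U) (N : forall a, connection E (U a)).
Hypothesis open_Ucap : forall p (J : 'I_p.+1 -> A), open (Ucap U J).
Notation C := (Cplx R).
Notation om := (omega_in N).

Lemma Ucap_sub p (J : 'I_p.+1 -> A) k : Ucap U J `<=` U (J k).
Proof. by move=> x; exact. Qed.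

Let oU a : open (U a).
Proof.
rewrite (_ : U a = Ucap U (fun _ : 'I_1 => a)) //.
by apply/seteqP; split=> [x Uax k|x /(_ ord0)].
Qed.

Lemma is_tot_at3 : is_tot U 6 (at3_tot N).
Proof.
split=> [p|p J].
  case: p => [|[|[|[|p]]]] _ J.
  - exact: is_form0.
  - by rewrite at3_tot1; apply: (is_form_pow5 N oU); exact: Ucap_sub.
  - by rewrite at3_tot2; apply: (is_form_rho N oU); exact: Ucap_sub.
  - by rewrite at3_tot3; apply: (is_form_tr3 N oU); exact: Ucap_sub.
  - exact: is_form0.
by case: p J => [|[|[|[|p]]]] J // _ i x.
Qed.

Hypothesis Nflat : forall a, flat (N a).

(** From bidegree (5, 2) on, all the components involved are zero. *)
Lemma tot_closed_at3 : tot_closed U (at3_tot N).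
Proof.
case=> [|[|[|[|[|p]]]]] J i x Jx ix; have oJ := open_Ucap J.
- exact: dform0.
- have Ja := @Ucap_sub _ J 0; have Jb := @Ucap_sub _ J 1.
  rewrite /tot_d [X in X + _]cech_form0 at3_tot1.
  rewrite (dform_pow5 oU Nflat oJ Jx ix Ja Jb).
  by rewrite add0r; exact: scaler0.
- have Ja := @Ucap_sub _ J 0; have Jb := @Ucap_sub _ J 1.
  have Jc := @Ucap_sub _ J 2.
  rewrite /tot_d at3_tot1 at3_tot2 cech_d1 signr2_scale.
  rewrite (dform_rho oU Nflat oJ Jx ix Ja Jb Jc).
  have [Ua Ub Uc] := And3 (Ja _ Jx) (Jb _ Jx) (Jc _ Jx).
  (* The face without J 0 is the only one written in another frame. *)
  have -> : pow5_form N (J 1) (J 2) i x = pow5_mx (om (J 0) (J 1) (J 2) i x).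
    rewrite /pow5_form (omega_conj N oU Ua Ub Ub Uc ix).
    exact: (pow5_mx_conj (trans_mxK E Ua Ub)).
  rewrite /pow5_form (omega_add N oU Ua Ua Ub Uc ix).
  by apply: pow5_rho; exact: (homogeneous_om N oU Jx ix).
- have Ja := @Ucap_sub _ J 0; have Jb := @Ucap_sub _ J 1.
  have Jc := @Ucap_sub _ J 2; have Jd := @Ucap_sub _ J 3.
  rewrite /tot_d at3_tot2 at3_tot3 cech_d2 signr3_scale.
  rewrite (dform_tr3 oU Nflat oJ Jx ix Ja Jb Jc Jd).
  have [Ua Ub Uc] := And3 (Ja _ Jx) (Jb _ Jx) (Jc _ Jx); have Ud := Jd _ Jx.
  have -> : rho_form N (J 1) (J 2) (J 3) i x =
      rho_mx (om (J 0) (J 1) (J 2) i x) (om (J 0) (J 2) (J 3) i x).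
    rewrite /rho_form (omega_conj N oU Ua Ub Ub Uc ix) (omega_conj N oU Ua Ub Uc Ud ix).
    exact: (rho_mx_conj _ _ (trans_mxK E Ua Ub)).
  rewrite /rho_form (omega_add N oU Ua Ua Ub Uc ix) (omega_add N oU Ua Ub Uc Ud ix).
  by apply: rho_tr; exact: (homogeneous_om N oU Jx ix).
- have Ja := @Ucap_sub _ J 0; have Jb := @Ucap_sub _ J 1.
  have Jc := @Ucap_sub _ J 2; have Jd := @Ucap_sub _ J 3.
  have Je := @Ucap_sub _ J 4.
  rewrite /tot_d at3_tot3 cech_d3 [X in _ *: X]dform0.
  have [Ua Ub Uc] := And3 (Ja _ Jx) (Jb _ Jx) (Jc _ Jx).
  have [Ud Ue] := conj (Jd _ Jx) (Je _ Jx).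
  have -> : tr3_form N (J 1) (J 2) (J 3) (J 4) i x =
      \tr (om (J 0) (J 1) (J 2) i x * om (J 0) (J 2) (J 3) i x
           * om (J 0) (J 3) (J 4) i x).
    rewrite /tr3_form (omega_conj N oU Ua Ub Ub Uc ix).
    rewrite (omega_conj N oU Ua Ub Uc Ud ix) (omega_conj N oU Ua Ub Ud Ue ix).
    exact: (tr3_conj (trans_mxK E Ua Ub)).
  rewrite /tr3_form (omega_add N oU Ua Ua Ub Uc ix) (omega_add N oU Ua Ub Uc Ud ix).
  rewrite (omega_add N oU Ua Uc Ud Ue ix) tr3_cocycle add0r.
  exact: scaler0.
- rewrite /tot_d [X in X + _]cech_form0 [X in _ *: X]dform0 add0r.
  exact: scaler0.
Qed.

End Closedness.

Theorem mainTheorem2 (R : realType) (X : cmanifold R) (A : Type)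
    (U : A -> set X) (E : vbundle U) (N : forall a, connection E (U a)) :
  paracompact X ->
  \bigcup_a U a = setT -> locally_finite_family U ->
  (forall p (a : 'I_p.+1 -> A), stein (Ucap U a)) ->
  (forall a, flat (N a)) ->
  [/\ is_tot U 6%N (at3_tot N),
      tot_closed U (at3_tot N) &
      forall a, eq_form (Ucap U a) (at3_tot N 3%N a) (mxtr (at3 N a))].
Proof.
move=> _ _ _ steinU flatN.
have oU p (J : 'I_p.+1 -> A) : open (Ucap U J) by have [] := steinU p J.
split; [exact: is_tot_at3|exact: tot_closed_at3|].
by move=> a i x _ _.
Qed.
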